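(* Let $X$ be a locally compact roughly starlike Gromov $\delta$-hyperbolic space (with base point $z_0$ and roughly-starlike constant $M$), equipped with a Borel measure $\mu$ which is doubling on $X$ for balls of radii at most $R_0$, with doubling constant $C_d$. Let $0<\varepsilon\le\varepsilon_0(\delta)$ and \[ \beta>\beta_0:=\frac{17\log C_d}{3R_0}. \] Then $\mu_\beta$ is globally doubling on $\overline{X}_\varepsilon$ (and on $X_\varepsilon$). Moreover, let $A=A(\delta)$ be the uniformity constant of $X_\varepsilon$, let $0<a_0<\min\{\tfrac18,\tfrac1{6A}\}$, let $x\in\overline{X}_\varepsilon$ and $0<r\le 2\operatorname{diam}_\varepsilon X_\varepsilon$. Then there exists $z\in X$ with $B_\varepsilon(z,a_0r)\subset B_\varepsilon(x,r)$ and $d_\varepsilon(z)\ge 2a_0 r$. For every such $z$, \[ \mu_\beta(B_\varepsilon(x,r))\simeq \mu_\beta(B_\varepsilon(z,a_0r)), \] where the comparison constants depend only on $\delta,M,\varepsilon,C_d,R_0,\beta,a_0$.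
   Context: A curve is a continuous map from a compact interval; rectifiable curves are parametrized by arc length $ds$. A metric space is geodesic if any two points are joined by a curve whose length equals their distance. A complete unbounded geodesic metric space $X$ is Gromov $\delta$-hyperbolic ($\delta\ge0$) if for all geodesics $[x,y],[y,z],[z,x]$ in $X$, every point of $[x,y]$ lies within distance $\delta$ of $[y,z]\cup[z,x]$. $X$ is roughly starlike with respect to $z_0\in X$ with constant $M>0$ if every $x\in X$ lies within distance $M$ of some geodesic ray starting at $z_0$ (a geodesic ray is a curve $\gamma:[0,\infty)\to X$ of infinite length with $\gamma|_{[0,t]}$ a geodesic for each $t$). Uniformization: for $\varepsilon>0$ put $\rho_\varepsilon(x)=e^{-\varepsilon d(x,z_0)}$ and $d_\varepsilon(x,y)=\inf_\gamma\int_\gamma\rho_\varepsilon\,ds$, the infimum over rectifiable curves in $X$ joining $x$ to $y$. $X_\varepsilon=(X,d_\varepsilon)$, $\overline{X}_\varepsilon$ is its completion, $\partial_\varepsilon X=\overline{X}_\varepsilon\setminus X_\varepsilon$, $d_\varepsilon(x)=\operatorname{dist}_\varepsilon(x,\partial_\varepsilon X)$, and $B_\varepsilon$, $\operatorname{diam}_\varepsilon$ refer to $d_\varepsilon$ while $B$ refers to $d$. A noncomplete metric space $\Omega$ is $A$-uniform if any $x,y\in\Omega$ can be joined by an arc-length parametrized curve $\gamma:[0,l]\to\Omega$ with $l\le A\,d(x,y)$ and $\operatorname{dist}(\gamma(t),\overline\Omega\setminus\Omega)\ge \frac1A\min\{t,l-t\}$ for all $t$. Known fact (Bonk–Heinonen–Koskela):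 there is $\varepsilon_0(\delta)>0$ depending only on $\delta$ such that for $0<\varepsilon\le\varepsilon_0(\delta)$, $X_\varepsilon$ is $A$-uniform with $A$ depending only on $\delta$ and $\overline{X}_\varepsilon$ is a compact geodesic space. A Borel measure $\nu$ on a metric space is doubling for balls of radii at most $R_0$ with constant $C_d$ if $0<\nu(B(x,2r))\le C_d\nu(B(x,r))<\infty$ for all $x$ and $0<r\le R_0$; globally doubling if this holds for all $r>0$. The measure $\mu_\beta$ is defined on $X$ by $d\mu_\beta=e^{-\beta d(\cdot,z_0)}\,d\mu$ and extended to $\overline{X}_\varepsilon$ by $\mu_\beta(\partial_\varepsilon X)=0$. *)

(* Defs.v *)
From HB Require Import structures.
From mathcomp Require Import all_boot all_order all_algebra.
From mathcomp Require Import all_classical all_reals all_analysis.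
Set Implicit Arguments. Unset Strict Implicit. Unset Printing Implicit Defensive.
Import Order.TTheory GRing.Theory Num.Theory.
Local Open Scope classical_set_scope.
Local Open Scope ring_scope.

Section MetricDefs.
Variable R : realType.

Definition is_metric (T : Type) (D : T -> T -> R) : Prop :=
  (forall x y, 0 <= D x y) /\ (forall x y, D x y = 0 <-> x = y) /\
  (forall x y, D x y = D y x) /\ (forall x y z, D x z <= D x y + D y z).

Definition mball (T : Type) (D : T -> T -> R) (x : T) (r : R) : set T :=
  [set y | D x y < r].

Definition mopen (T : Type) (D : T -> T -> R) (U : set T) : Prop :=
  forall x, U x -> exists2 r, 0 < r & mball D x r `<=` U.

Definition mcompact (T : Type) (D : T -> T -> R) (K : set T) : Prop :=
  forall (I : Type) (U : I -> set T), (forall i, mopen D (U i)) ->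
    K `<=` \bigcup_(i in setT) U i ->
    exists2 F : set I, finite_set F & K `<=` \bigcup_(i in F) U i.

Definition locally_compact (T : Type) (D : T -> T -> R) : Prop :=
  forall x, exists K, mcompact D K /\ exists2 r, 0 < r & mball D x r `<=` K.

Definition mcomplete (T : Type) (D : T -> T -> R) : Prop :=
  forall u : nat -> T,
    (forall e, 0 < e -> exists N, forall m n, (N <= m)%N -> (N <= n)%N ->
        D (u m) (u n) < e) ->
    exists l, forall e, 0 < e -> exists N, forall n, (N <= n)%N -> D (u n) l < e.

Definition munbounded (T : Type) (D : T -> T -> R) : Prop :=
  forall x K, exists y, K < D x y.

(* a curve gamma : [a,b] -> T (values outside [a,b] are irrelevant) *)
Definition curve (T : Type) (D : T -> T -> R) (g : R -> T) (a b : R) : Prop :=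
  a <= b /\ forall t, a <= t <= b -> forall e, 0 < e -> exists2 h, 0 < h &
    forall t', a <= t' <= b -> `|t - t'| < h -> D (g t) (g t') < e.

Definition partition (p : nat -> R) (n : nat) (s t : R) : Prop :=
  p 0%N = s /\ p n = t /\ forall i, (i < n)%N -> p i <= p i.+1.

Definition psum (T : Type) (D : T -> T -> R) (g : R -> T) (p : nat -> R) (n : nat) : R :=
  \sum_(i < n) D (g (p i)) (g (p i.+1)).

Definition is_length (T : Type) (D : T -> T -> R) (g : R -> T) (s t L : R) : Prop :=
  (forall p n, partition p n s t -> psum D g p n <= L) /\
  (forall e, 0 < e -> exists p n, partition p n s t /\ L - e < psum D g p n).

Definition geodesic_curve (T : Type) (D : T -> T -> R) (g : R -> T) (a b : R) (x y : T) : Prop :=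
  curve D g a b /\ g a = x /\ g b = y /\ is_length D g a b (D x y).

Definition geodesic_space (T : Type) (D : T -> T -> R) : Prop :=
  forall x y, exists g a b, geodesic_curve D g a b x y.

Definition image_on (T : Type) (g : R -> T) (a b : R) : set T :=
  [set g t | t in [set t | a <= t <= b]].

Definition dist_le (T : Type) (D : T -> T -> R) (p : T) (S : set T) (c : R) : Prop :=
  forall e, 0 < e -> exists2 q, S q & D p q < c + e.

Definition gromov_hyperbolic (T : Type) (D : T -> T -> R) (delta : R) : Prop :=
  forall x y z g1 a1 b1 g2 a2 b2 g3 a3 b3,
    geodesic_curve D g1 a1 b1 x y -> geodesic_curve D g2 a2 b2 y z ->
    geodesic_curve D g3 a3 b3 z x ->
    forall p, image_on g1 a1 b1 p ->
      dist_le D p (image_on g2 a2 b2 `|` image_on g3 a3 b3) delta.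

Definition hyperbolic_space (T : Type) (D : T -> T -> R) (delta : R) : Prop :=
  is_metric D /\ mcomplete D /\ munbounded D /\ geodesic_space D /\
  0 <= delta /\ gromov_hyperbolic D delta.

Definition geodesic_ray (T : Type) (D : T -> T -> R) (g : R -> T) (z0 : T) : Prop :=
  g 0 = z0 /\ (forall t, 0 <= t -> geodesic_curve D g 0 t (g 0) (g t)) /\
  (forall K, exists2 t, 0 <= t & K < D (g 0) (g t)).

Definition roughly_starlike (T : Type) (D : T -> T -> R) (z0 : T) (M : R) : Prop :=
  0 < M /\ forall x, exists g, geodesic_ray D g z0 /\
     dist_le D x [set g t | t in [set t | 0 <= t]] M.

Definition arclength (T : Type) (D : T -> T -> R) (g : R -> T) (l : R) : Prop :=
  curve D g 0 l /\ forall s t, 0 <= s -> s <= t -> t <= l -> is_length D g s t (t - s).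

Definition rho_eps (T : Type) (D : T -> T -> R) (z0 : T) (eps : R) (x : T) : R :=
  expR (- (eps * D x z0)).

Definition d_eps (T : Type) (D : T -> T -> R) (z0 : T) (eps : R) (x y : T) : R :=
  inf [set v | exists g l, [/\ arclength D g l, g 0 = x, g l = y &
         v = fine (\int[@lebesgue_measure R]_(t in [set t : R | 0 <= t <= l])
                     (rho_eps D z0 eps (g t))%:E)]].

Definition completion_of (T Y : Type) (E : T -> T -> R) (dY : Y -> Y -> R) (iota : T -> Y) : Prop :=
  is_metric dY /\ mcomplete dY /\ (forall x y, dY (iota x) (iota y) = E x y) /\
  (forall y e, 0 < e -> exists x, dY (iota x) y < e).

Definition bdry (T Y : Type) (iota : T -> Y) : set Y := ~` range iota.

Definition uniform_space (T Y : Type) (E : T -> T -> R) (dY : Y -> Y -> R) (iota : T -> Y) (A : R) : Prop :=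
  (exists w, bdry iota w) /\
  forall x y, exists g l, [/\ arclength E g l, g 0 = x, g l = y, l <= A * E x y &
     forall t, 0 <= t <= l -> forall w, bdry iota w ->
        Num.min t (l - t) / A <= dY (iota (g t)) w].

Definition diam (T : Type) (E : T -> T -> R) : R := sup [set E x y | x in setT & y in setT].

Definition standing_space (T : Type) (D : T -> T -> R) (z0 : T) (delta M : R) : Prop :=
  hyperbolic_space D delta /\ locally_compact D /\ roughly_starlike D z0 M.

(* Bonk-Heinonen-Koskela: for 0 < eps <= eps0 delta, X_eps is (A delta)-uniform and
   its completion is a compact geodesic space. *)
Definition BHK_property (eps0 A : R -> R) : Prop :=
  forall (T Y : Type) (D : T -> T -> R) (z0 : T) (delta M eps : R)
         (dY : Y -> Y -> R) (iota : T -> Y),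
    standing_space D z0 delta M -> 0 < eps -> eps <= eps0 delta ->
    completion_of (d_eps D z0 eps) dY iota ->
    uniform_space (d_eps D z0 eps) dY iota (A delta) /\ mcompact dY setT /\ geodesic_space dY.

Definition borel_measurable (d : measure_display) (T : measurableType d) (D : T -> T -> R) : Prop :=
  (@measurable d T) = <<s [set U | mopen D U] >>.

Definition doubling_upto (d : measure_display) (T : measurableType d) (D : T -> T -> R)
  (mu : {measure set T -> \bar R}) (R0 Cd : R) : Prop :=
  forall x r, 0 < r -> r <= R0 ->
    [/\ (0 < mu (mball D x (2 * r)))%E, (mu (mball D x (2 * r)) <= Cd%:E * mu (mball D x r))%E
      & (mu (mball D x r) < +oo)%E].

(* mu_beta(S) for S a subset of X; on the completion mu_beta(S) := mu_beta(iota^-1 S)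
   since mu_beta(boundary) = 0 *)
Definition mu_beta (d : measure_display) (T : measurableType d) (D : T -> T -> R) (z0 : T)
  (mu : {measure set T -> \bar R}) (beta : R) (S : set T) : \bar R :=
  \int[mu]_(x in S) (expR (- (beta * D x z0)))%:E.

Definition globally_doubling (U : Type) (E : U -> U -> R) (nu : set U -> \bar R) : Prop :=
  exists C : R, forall x r, 0 < r ->
    [/\ (0 < nu (mball E x (2 * r)))%E, (nu (mball E x (2 * r)) <= C%:E * nu (mball E x r))%E
      & (nu (mball E x r) < +oo)%E].

Definition standing (d : measure_display) (T : measurableType d) (D : T -> T -> R) (z0 : T)
  (mu : {measure set T -> \bar R}) (delta M R0 Cd : R) : Prop :=
  standing_space D z0 delta M /\ borel_measurable D /\ 0 < R0 /\ doubling_upto D mu R0 Cd.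

End MetricDefs.

(* Main.v *)
Require Import Defs.
From HB Require Import structures.
From mathcomp Require Import all_boot all_order all_algebra.
From mathcomp Require Import all_classical all_reals all_analysis.
From mathcomp Require Import measurable_realfun ring lra.
Set Implicit Arguments. Unset Strict Implicit. Unset Printing Implicit Defensive.
Import Order.TTheory GRing.Theory Num.Theory.
Import numFieldNormedType.Exports.
Local Open Scope classical_set_scope.
Local Open Scope ring_scope.

(** Write [rho x = exp (- eps * D x z0)] and [E = d_eps D z0 eps].  Integrating [rho]
    along curves gives [rho x * (1 - exp (- eps * D x y)) / eps <= E x y], and
    [E x y <= (rho x - rho y) / eps] when [x] lies between [z0] and [y]; with rough
    starlikeness, the distance of [x] to the boundary is comparable to [rho x].

    Let [z] be at distance at least [2 * a * r] from the boundary.  If [rho z] is large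
    compared with [r], the balls [E z y < a * r] and [E z y < L * r] lie between
    [D]-balls of comparable radii at most [R0], where [mu] is doubling.  Otherwise every
    [y] with [E z y < L * r] satisfies [D y z0 >= D z z0 + D y z - const], so
    [mu_beta] of the large ball is at most a constant times
    [exp (- beta * D z z0)] times the integral of [exp (- beta * D y z)].  A maximal
    [R0]-separated set shows [mu (B x (r + R0 / 2)) <= Cd^2 * mu (B x r)], so this
    integral is bounded by a multiple of [mu (B z R0)] as soon as
    [beta > 4 * ln Cd / R0], which is weaker than [beta > 17 * ln Cd / (3 * R0)]. *)

(** * Continuity and integrals on the real line *)

Section RealLine.
Context {R : realType}.
Implicit Types (f : R -> R) (a b l : R).

Lemma epsdelta_continuous f :
  (forall t e, 0 < e -> exists2 h, 0 < h &
     forall t', `|t - t'| < h -> `|f t - f t'| < e) -> continuous f.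
Proof.
move=> H t; apply/cvgrPdist_lt => e e0.
have [h h0 Hh] := H t e e0.
near=> t'; apply: Hh.
near: t'; exact: (@cvgr_dist_lt _ _ _ _ _ id t).
Unshelve. all: by end_near. Qed.

(** Precomposition with this retraction onto [[a, b]] (for [a <= b]) extends a function controlled
    only on [[a, b]] to a continuous function on the whole line. *)
Definition clamp a b t := Num.max a (Num.min t b).

Lemma clamp_itv a b t : a <= b -> a <= clamp a b t <= b.
Proof. by move=> ab; rewrite /clamp le_max lexx ge_max ab ge_min lexx orbT. Qed.

Lemma clamp_id a b t : a <= t <= b -> clamp a b t = t.
Proof. by move=> /andP[at_ tb]; rewrite /clamp (min_idPl tb) (max_idPr at_). Qed.

Lemma clamp_dist a b s t : `|clamp a b s - clamp a b t| <= `|s - t|.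
Proof.
rewrite /clamp ler_norml.
have := ler_norm (s - t); have := ler_norm (t - s); rewrite (distrC t s).
by case: (leP s b) => ?; case: (leP t b) => ?;
  rewrite /Num.max; do !case: ifPn; rewrite -?leNgt; lra.
Qed.

Lemma integral_expRN a l : 0 < a -> 0 <= l ->
  (\int[@lebesgue_measure R]_(t in [set t : R | (0 <= t <= l)%R]) (expR (- (a * t)))%:E
    = ((1 - expR (- (a * l))) / a)%:E)%E.
Proof.
move=> a0; rewrite le_eqVlt => /predU1P[<-|l0].
  have -> : [set t : R | 0 <= t <= 0] = [set 0].
    by apply/seteqP; split => t /=; [move=> /andP[? ?]; apply/eqP; lra | move=> ->; lra].
  by rewrite integral_set1 mulr0 oppr0 expR0 subrr mul0r.
pose F (t : R) : R := - (expR (- (a * t)) / a).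
have dF (t : R) : is_derive t (1 : R) F (expR (- (a * t))).
  rewrite /F; apply: is_derive_eq.
  by rewrite /GRing.scale /= ?mulr0 ?addr0 ?add0r; field; lra.
rewrite set_itvcc (@continuous_FTC2 _ _ F)//.
- by rewrite -EFinB /F mulr0 oppr0 expR0; congr EFin; field; lra.
- apply: continuous_subspaceT => t.
  apply: continuous_comp; last exact: continuous_expR.
  by apply: continuousN; apply: cvgM => //; exact: cvg_cst.
- split.
  + by move=> t _; apply: ex_derive.
  + apply: cvg_at_right_filter; apply: differentiable_continuous.
    exact/derivable1_diffP/ex_derive.
  + apply: cvg_at_left_filter; apply: differentiable_continuous.
    exact/derivable1_diffP/ex_derive.
- by move=> t _; rewrite derive1E; apply: derive_val.
Qed.

End RealLine.

(** * Lengths and geodesics in a metric space *)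

Section MetricGeometry.
Context {R : realType} {T : Type} (D : T -> T -> R).
Hypothesis mD : is_metric D.

Lemma is_metric_ge0 x y : 0 <= D x y. Proof. by case: mD. Qed.

Lemma is_metric_refl x : D x x = 0. Proof. by case: mD => _ [/(_ x x)[_ ->]]. Qed.

Lemma is_metric_eq0 x y : D x y = 0 -> x = y.
Proof. by case: mD => _ [/(_ x y)[]]. Qed.

Lemma is_metric_sym x y : D x y = D y x. Proof. by case: mD => _ [_ []]. Qed.

Lemma is_metric_tri y x z : D x z <= D x y + D y z.
Proof. by case: mD => _ [_ []]. Qed.

Lemma is_metric_distl x y z : `|D x z - D y z| <= D x y.
Proof.
rewrite ler_norml.
have := is_metric_tri y x z; have := is_metric_tri x y z; rewrite (is_metric_sym y x); lra.
Qed.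

Lemma mopen_mball x r : mopen D (mball D x r).
Proof.
move=> y /= xy; exists (r - D x y); first by rewrite subr_gt0.
by move=> z /= yz; rewrite /mball /=; have := is_metric_tri y x z; move: yz; rewrite /mball /=; lra.
Qed.

Lemma arclength_dist g l s t :
  arclength D g l -> 0 <= s -> s <= t -> t <= l -> D (g s) (g t) <= t - s.
Proof.
move=> [_ H] s0 st tl; have [+ _] := H s t s0 st tl.
move=> /(_ (fun i => if i is 0%N then s else t) 1%N).
rewrite /psum big_ord1 /=; apply; split => //; split => //.
by case.
Qed.

Lemma partition_itv (p : nat -> R) n s t i :
  Defs.partition p n s t -> (i <= n)%N -> s <= p i <= t.
Proof.
move=> [<- [<- H]] iN; apply/andP; split.
  elim: i iN => // i IH iN; apply: le_trans (H i iN); apply: IH; exact: ltnW.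
have mono k : (i + k <= n)%N -> p i <= p (i + k)%N.
  elim: k => [|k IH]; first by rewrite addn0.
  rewrite addnS => ikN; apply: le_trans (H _ ikN); apply: IH; exact: ltnW.
by rewrite -[X in _ <= p X](subnKC iN); apply: mono; rewrite subnKC.
Qed.

Lemma isometric_arclength g l : 0 <= l ->
  (forall s t, 0 <= s <= l -> 0 <= t <= l -> D (g s) (g t) = `|s - t|) ->
  arclength D g l.
Proof.
move=> l0 iso; split; first split => // t tl e e0.
  by exists e => // t' t'l tt'; rewrite iso.
move=> s t s0 st tl; split => [p n pP|e e0]; last first.
  exists (fun i => if i is 0%N then s else t), 1%N.
  split; first by split => //; split => //; case.
  by rewrite /psum big_ord1 /= iso; [rewrite distrC ger0_norm; lra|lra|lra].
have pI i : (i <= n)%N -> 0 <= p i <= l.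
  by move=> /(partition_itv pP); lra.
have -> : psum D g p n = \sum_(0 <= i < n) (p i.+1 - p i).
  rewrite /psum big_mkord; apply: eq_bigr => i _.
  rewrite iso ?pI ?(ltnW (ltn_ord i))//.
  by case: pP => _ [_ /(_ i (ltn_ord i))] ?; rewrite distrC ger0_norm// subr_ge0.
by rewrite telescope_sumr//; case: pP => -> [-> _].
Qed.

(** The partition [a, s, t, b] has sum at most the length [D x y], so the triangle inequalities
    along it are equalities. *)
Lemma geodesic_additive g a b x y s t : geodesic_curve D g a b x y ->
  a <= s -> s <= t -> t <= b -> D x (g s) + D (g s) (g t) = D x (g t).
Proof.
move=> [_ [ga [gb [L _]]]] as_ st tb.
(* The default value [b] of [nth] serves as the last partition point. *)
have := L (fun i => nth b [:: a; s; t] i) 3%N.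
rewrite /psum !big_ord_recr big_ord0 /= ga gb => /(_ _).
have pP : Defs.partition (fun i => nth b [:: a; s; t] i) 3 a b.
  by split => //; split => //; case=> [|[|[|]]].
move=> /(_ pP).
have := is_metric_tri (g t) x y; have := is_metric_tri (g s) x (g t); lra.
Qed.

Hypothesis gD : geodesic_space D.

(** A [geodesic_curve] may have any parametrization. The distance from [x] is continuous along it
    and takes every value between [0] and [D x y], so it can serve as the new parameter;
    [geodesic_additive] makes the result isometric. *)
Lemma geodesic_param x y : exists g : R -> T, [/\ g 0 = x, g (D x y) = y &
  forall s t, 0 <= s <= D x y -> 0 <= t <= D x y -> D (g s) (g t) = `|s - t|].
Proof.
have [f [a [b fP]]] := gD x y.
have [[ab cf] [fa [fb _]]] := fP.
have add := geodesic_additive fP.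
pose h t := D x (f (clamp a b t)).
have ch : continuous h.
  apply: epsdelta_continuous => t e e0.
  have [k k0 Hk] := cf (clamp a b t) (clamp_itv t ab) e e0.
  exists k => // t' tt'; rewrite /h (is_metric_sym x) (is_metric_sym x).
  apply: le_lt_trans (is_metric_distl _ _ _) _; apply: Hk; first exact: clamp_itv.
  exact: le_lt_trans (clamp_dist _ _ _ _) tt'.
have ha : h a = 0 by rewrite /h clamp_id ?lexx// fa is_metric_refl.
have hb : h b = D x y by rewrite /h clamp_id ?lexx ?ab// fb.
have xy0 := is_metric_ge0 x y.
(* The condition on [u] stays inside the existential, with [0] as dummy value, so that [choice]
   gives a function on the whole line. *)
have lift u : exists t, 0 <= u <= D x y -> a <= t <= b /\ D x (f t) = u.
  have [uI|] := boolP (0 <= u <= D x y); last by exists 0.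
  have : exists2 t, t \in `[a, b] & h t = u.
    apply: IVT => //; first exact: continuous_subspaceT.
    by rewrite ha hb (min_idPl xy0) (max_idPr xy0).
  move=> [t]; rewrite in_itv /= => tab htu; exists t => _; split => //.
  by rewrite -htu /h clamp_id.
have [k kP] := choice lift.
have dk s t : 0 <= s <= D x y -> 0 <= t <= D x y -> k s <= k t ->
    D (f (k s)) (f (k t)) = t - s.
  move=> /kP[/andP[? ?] es] /kP[/andP[? ?] et] st.
  by have := add (k s) (k t); rewrite es et; lra.
exists (f \o k); split => /=.
- by apply: esym; apply: is_metric_eq0; have [|_ ->] := kP 0; rewrite ?lexx ?xy0.
- apply: is_metric_eq0; have [|/andP[? ?] e] := kP (D x y); first by rewrite lexx xy0.
  have := add (k (D x y)) b; rewrite e fb; lra.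
- move=> s t sI tI; have [st|ts] := leP (k s) (k t).
    have e := dk s t sI tI st; have := is_metric_ge0 (f (k s)) (f (k t)).
    by rewrite e => ?; rewrite distrC ger0_norm.
  have e := dk t s tI sI (ltW ts); rewrite is_metric_sym e ger0_norm// -e.
  exact: is_metric_ge0.
Qed.

Lemma geodesic_split x y a b : 0 < a -> 0 < b -> D x y < a + b ->
  exists2 z, D x z < a & D z y < b.
Proof.
move=> a0 b0 xyab.
have [xya|axy] := ltP (D x y) a; first by exists y => //; rewrite is_metric_refl.
have [xyb|bxy] := ltP (D x y) b; first by exists x => //; rewrite is_metric_refl.
have [g [g0 g1 iso]] := geodesic_param x y.
have xy0 := is_metric_ge0 x y.
(* The midpoint of the interval [(D x y - b, a)] of admissible parameters, which lies in
   [[0, D x y]] in the remaining case. *)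
exists (g ((a + D x y - b) / 2)).
  by rewrite -{1}g0 iso; [rewrite sub0r normrN ger0_norm; lra|lra|lra].
by rewrite -{2}g1 iso; [rewrite distrC ger0_norm; lra|lra|lra].
Qed.

(** Pieces of length [h] are cut off from the end of the curve. This turns a comparison of metrics
    at small scale into one along a whole curve. *)
Lemma chain_dist (g : R -> T) h c n l : 0 <= h -> 0 <= c -> 0 <= l -> l <= n%:R * h ->
  (forall s t, 0 <= s -> s <= t -> t <= l -> t - s <= h -> D (g s) (g t) <= c) ->
  D (g 0) (g l) <= n%:R * c.
Proof.
move=> h0 c0; elim: n l => [|n IH] l l0 ln step.
  have -> : l = 0 by lra.
  by rewrite is_metric_refl mul0r.
rewrite -natr1 mulrDl mul1r in ln; rewrite -natr1 [leRHS]mulrDl mul1r.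
have nc0 : 0 <= n%:R * c by rewrite mulr_ge0.
have [lh|hl] := leP l h.
  by apply: le_trans (step 0 l _ _ _ _) _; lra.
apply: le_trans (is_metric_tri (g (l - h)) _ _) _; apply: lerD.
  by apply: IH; [lra|lra|move=> s t s0 st tl; apply: step; lra].
by apply: step; lra.
Qed.

End MetricGeometry.

(** * Elementary bounds on the exponential *)

Section ExpBounds.
Context {R : realType}.
Implicit Types x : R.

Lemma expRN_le1 x : 0 <= x -> expR (- x) <= 1.
Proof. by move=> x0; rewrite -expR0 ler_expR oppr_le0. Qed.

Lemma expRN_lt x e : 0 < e -> e^-1 <= x -> expR (- x) < e.
Proof.
move=> e0 ex; rewrite expRN invf_plt ?posrE ?expR_gt0//.
by have := expR_ge1Dx x; lra.
Qed.

Lemma subr1_expRN_inv x u : 0 <= x -> u <= 2^-1 -> 1 - expR (- x) <= u -> x <= 2 * u.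
Proof.
(* [1 - exp (- x) >= x / (1 + x)] because [exp x >= 1 + x] *)
move=> x0 u2 H; have ex := expR_ge1Dx x.
have : expR (- x) * expR x = 1 by rewrite -expRD addNr expR0.
have := expR_gt0 (- x); nra.
Qed.

End ExpBounds.

(** * Estimates for the uniformized metric *)

Section Uniformization.
Context {R : realType} {T : Type} (D : T -> T -> R) (z0 : T) (eps : R).
Hypothesis mD : is_metric D.
Hypothesis gD : geodesic_space D.
Hypothesis eps_gt0 : 0 < eps.

Notation rho := (rho_eps D z0 eps).
Notation E := (d_eps D z0 eps).
Notation leb := (@lebesgue_measure R).
Notation seg l := [set t : R | 0 <= t <= l].

Let ge0D := is_metric_ge0 mD.
Let symD := is_metric_sym mD.
Let triD := is_metric_tri mD.

Lemma rho_gt0 x : 0 < rho x. Proof. exact: expR_gt0. Qed.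

Lemma rho_le1 x : rho x <= 1.
Proof. by apply: expRN_le1; exact: mulr_ge0 (ltW eps_gt0) (ge0D _ _). Qed.

Lemma rho_base : rho z0 = 1.
Proof. by rewrite /rho_eps is_metric_refl// mulr0 oppr0 expR0. Qed.

Lemma rho_harnack x y : rho y <= expR (eps * D x y) * rho x.
Proof.
rewrite /rho_eps -expRD ler_expR.
by have := ler_wpM2l (ltW eps_gt0) (triD y x z0); lra.
Qed.

Lemma measurable_seg l : measurable (seg l).
Proof. by rewrite -set_itvcc. Qed.

Lemma measurable_rho_curve g l : arclength D g l ->
  measurable_fun (seg l) (EFin \o (fun t : R => rho (g t))).
Proof.
move=> ag; have l0 : 0 <= l by case: ag => [[]].
apply/measurable_EFinP.
apply: (eq_measurable_fun (fun t => rho (g (clamp 0 l t)))).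
  by move=> t; rewrite inE /= => tl; rewrite clamp_id.
apply: measurable_funTS; apply: continuous_measurable_fun.
have cD : continuous (fun t => D (g (clamp 0 l t)) z0).
  apply: epsdelta_continuous => t e e0; exists e => // t' tt'.
  apply: le_lt_trans (is_metric_distl mD _ _ _) _.
  apply: le_lt_trans tt'; apply: le_trans (clamp_dist 0 l _ _).
  have /andP[c0 cl] := clamp_itv t l0; have /andP[c0' cl'] := clamp_itv t' l0.
  have [tt'|t't] := leP (clamp 0 l t) (clamp 0 l t').
    by rewrite distrC ger0_norm ?subr_ge0//; apply: arclength_dist ag _ _ _.
  rewrite symD ger0_norm ?subr_ge0 ?(ltW t't)//.
  by apply: arclength_dist ag _ _ _ => //; exact: ltW.
move=> t; apply: continuous_comp; last exact: continuous_expR.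
by apply: continuousN; apply: cvgM; [exact: cvg_cst|exact: cD].
Qed.

Lemma lebesgue_seg l : 0 <= l -> leb (seg l) = l%:E.
Proof.
move=> l0; rewrite -set_itvcc lebesgue_measure_itv /= lte_fin.
by case: ltP => [_|?]; [rewrite sube0|congr EFin; lra].
Qed.

Lemma rho_length_ge0 g l : (0 <= \int[leb]_(t in seg l) (rho (g t))%:E)%E.
Proof. by apply: integral_ge0 => t _; rewrite lee_fin ltW// rho_gt0. Qed.

Lemma rho_length_fin g l : arclength D g l ->
  (\int[leb]_(t in seg l) (rho (g t))%:E)%E \is a fin_num.
Proof.
move=> ag; have l0 : 0 <= l by case: ag => [[]].
rewrite ge0_fin_numE ?rho_length_ge0//.
apply: (@le_lt_trans _ _ (\int[leb]_(t in seg l) 1%:E)%E).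
  apply: ge0_le_integral => //.
  - exact: measurable_seg.
  - by move=> t _; rewrite lee_fin ltW// rho_gt0.
  - exact: measurable_rho_curve.
  - by move=> t _; rewrite lee_fin rho_le1.
rewrite integral_cst; last exact: measurable_seg.
by rewrite mul1e [X in (X < _)%E](_ : _ = l%:E) ?ltry//; exact: lebesgue_seg.
Qed.

Lemma geodesic_arclength x y : exists g : R -> T, [/\ g 0 = x, g (D x y) = y,
  arclength D g (D x y) &
  forall t, 0 <= t <= D x y -> D x (g t) = t /\ D (g t) y = D x y - t].
Proof.
have [g [g0 g1 iso]] := geodesic_param mD gD x y.
have xy0 := ge0D x y.
exists g; split => //; first exact: isometric_arclength.
move=> t tI; rewrite -{1}g0 -{1}g1 !iso; try lra.
by rewrite sub0r normrN distrC !ger0_norm; lra.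
Qed.

(** All competitors are nonnegative, so a single curve bounds the infimum from above; the majorant
    [f] is there to make the integral explicit. *)
Lemma d_eps_le_integral g l (f : R -> R) v : arclength D g l ->
  measurable_fun (seg l) (EFin \o f) ->
  (forall t, 0 <= t <= l -> rho (g t) <= f t) ->
  (\int[leb]_(t in seg l) (f t)%:E = v%:E)%E -> E (g 0) (g l) <= v.
Proof.
move=> ag mf rf fv.
apply: (@le_trans _ _ (fine (\int[leb]_(t in seg l) (rho (g t))%:E)%E)).
  apply: ge_inf; last by exists g, l.
  by exists 0 => _ [k [m [_ _ _ ->]]]; exact: fine_ge0 (rho_length_ge0 _ _).
rewrite -lee_fin fineK; last exact: rho_length_fin.
rewrite -fv; apply: ge0_le_integral => //.
- exact: measurable_seg.
- by move=> t _; rewrite lee_fin ltW// rho_gt0.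
- exact: measurable_rho_curve.
Qed.

Lemma d_eps_le_mul c x y :
  (forall z, D x z <= D x y -> rho z <= c) -> E x y <= c * D x y.
Proof.
move=> rc; have [g [g0 g1 ag gt]] := geodesic_arclength x y.
rewrite -{1}g0 -{1}g1; apply: (@d_eps_le_integral _ _ (fun=> c)) ag _ _ _.
- exact: measurable_cst.
- by move=> t tI; apply: rc; have [-> _] := gt t tI; lra.
- rewrite integral_cst; last exact: measurable_seg.
  by rewrite EFinM; congr (_ * _)%E; exact: lebesgue_seg (ge0D _ _).
Qed.

Lemma d_eps_le_dist x y : E x y <= D x y.
Proof. by rewrite -[leRHS]mul1r; apply: d_eps_le_mul => z _; exact: rho_le1. Qed.

Lemma d_eps_le x y : E x y <= expR (eps * D x y) * rho x * D x y.
Proof.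
apply: d_eps_le_mul => z xz; apply: le_trans (rho_harnack x z) _.
by rewrite ler_pM2r ?rho_gt0// ler_expR ler_pM2l.
Qed.

Lemma integral_scaled_expRN c l : 0 <= c -> 0 <= l ->
  (\int[leb]_(t in seg l) (c * expR (- (eps * t)))%:E
    = (c * (1 - expR (- (eps * l))) / eps)%:E)%E.
Proof.
move=> c0 l0; under eq_integral do rewrite EFinM.
rewrite ge0_integralZl_EFin//; first by rewrite integral_expRN// -EFinM mulrA.
- exact: measurable_seg.
- apply/measurable_EFinP; apply: measurable_funTS; apply: continuous_measurable_fun => t.
  apply: continuous_comp; last exact: continuous_expR.
  by apply: continuousN; apply: cvgM => //; exact: cvg_cst.
Qed.

Lemma measurable_scaled_expRN c l :
  measurable_fun (seg l) (EFin \o (fun t => c * expR (- (eps * t)))).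
Proof.
apply/measurable_EFinP; apply: measurable_funTS; apply: continuous_measurable_fun => t.
apply: cvgM; first exact: cvg_cst.
apply: continuous_comp; last exact: continuous_expR.
by apply: continuousN; apply: cvgM => //; exact: cvg_cst.
Qed.

(** With [x] between [z0] and [y], the triangle inequality gives [D (g t) z0 >= D x z0 + t] along a
    geodesic from [x] to [y], so [rho] is at most [rho x * expR (- (eps * t))] there. *)
Lemma d_eps_radial x y : D z0 y = D z0 x + D x y -> E x y <= (rho x - rho y) / eps.
Proof.
move=> xy; have [g [g0 g1 ag gt]] := geodesic_arclength x y.
have -> : rho x - rho y = rho x * (1 - expR (- (eps * D x y))).
  rewrite mulrBr mulr1 /rho_eps -expRD; congr (_ - expR _).
  by rewrite (symD y) xy (symD x z0); ring.
rewrite -{1}g0 -{1}g1.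
apply: (@d_eps_le_integral _ _ (fun t => rho x * expR (- (eps * t)))) ag _ _ _.
- exact: measurable_scaled_expRN.
- move=> t tI; rewrite /rho_eps -expRD ler_expR.
  have [_ e] := gt t tI.
  have := ler_wpM2l (ltW eps_gt0) (triD (g t) z0 y).
  by rewrite e xy (symD (g t)) (symD x z0); lra.
- exact: integral_scaled_expRN (ltW (rho_gt0 x)) (ge0D x y).
Qed.

(** On any arc-length curve from [x], [D (g t) z0 <= D x z0 + t], so [rho] decays no faster than
    [rho x * expR (- (eps * t))]; and a curve that reaches [y] has length at least [D x y]. *)
Lemma d_eps_ge x y : rho x * (1 - expR (- (eps * D x y))) / eps <= E x y.
Proof.
(* This geodesic shows that the infimum is over a nonempty set. *)
have [k [k0 k1 ak _]] := geodesic_arclength x y.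
apply: lb_le_inf; first by eexists; exists k, (D x y).
move=> _ [g [l [ag g0 g1 ->]]].
have l0 : 0 <= l by case: ag => [[]].
have xyl : D x y <= l.
  by rewrite -{1}g0 -{1}g1 -{2}(subr0 l); apply: arclength_dist ag _ _ _.
apply: (@le_trans _ _ (rho x * (1 - expR (- (eps * l))) / eps)).
  rewrite ler_pM2r ?invr_gt0// ler_pM2l ?rho_gt0// lerB// ler_expR lerN2.
  by rewrite ler_pM2l.
rewrite -lee_fin fineK; last exact: rho_length_fin.
rewrite -(integral_scaled_expRN (ltW (rho_gt0 x)) l0); apply: ge0_le_integral => //.
- exact: measurable_seg.
- by move=> t _; rewrite lee_fin mulr_ge0 ?expR_ge0// ltW// rho_gt0.
- exact: measurable_scaled_expRN.
- exact: measurable_rho_curve.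
- move=> t /= /andP[t0 tl]; rewrite lee_fin /rho_eps -expRD ler_expR.
  have := ler_wpM2l (ltW eps_gt0) (arclength_dist ag (lexx _) t0 tl).
  have := ler_wpM2l (ltW eps_gt0) (triD x (g t) z0).
  by rewrite g0 subr0 (symD (g t) x); lra.
Qed.

Lemma rho_lipschitz x y : rho x - rho y <= eps * E x y.
Proof.
have := d_eps_ge x y; rewrite ler_pdivrMr// (mulrC _ eps); apply: le_trans.
rewrite mulrBr mulr1 lerB// /rho_eps -expRD ler_expR.
by have := ler_wpM2l (ltW eps_gt0) (triD x y z0); rewrite (symD y x); lra.
Qed.

(** Inverts [d_eps_ge]: an [E]-distance small compared with [rho x] controls the [D]-distance. *)
Lemma dist_le_d_eps x y c : eps * E x y <= c * rho x -> c <= 2^-1 ->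
  eps * D x y <= 2 * c.
Proof.
move=> Ec c2; apply: subr1_expRN_inv => //; first exact: mulr_ge0 (ltW eps_gt0) (ge0D _ _).
have := d_eps_ge x y; rewrite ler_pdivrMr// => H.
have := rho_gt0 x; nra.
Qed.

End Uniformization.

(** * The boundary and the completion of the uniformized space *)

Lemma invS_lt (R : realType) (e : R) : 0 < e ->
  exists N, forall n, (N <= n)%N -> n.+1%:R^-1 < e.
Proof.
move=> e0; exists (Num.truncn e^-1) => n Nn.
rewrite invf_plt ?posrE ?ltr0n//.
apply: lt_le_trans (truncnS_gt _) _.
by rewrite ler_nat ltnS.
Qed.

Section UniformizedBoundary.
Context {R : realType} {T Y : Type} (D : T -> T -> R) (z0 : T) (eps : R).
Context (dY : Y -> Y -> R) (iota : T -> Y).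
Hypothesis mD : is_metric D.
Hypothesis gD : geodesic_space D.
Hypothesis eps_gt0 : 0 < eps.
Hypothesis cY : completion_of (d_eps D z0 eps) dY iota.

Notation rho := (rho_eps D z0 eps).
Notation E := (d_eps D z0 eps).

Let mY : is_metric dY. Proof. by case: cY. Qed.
Let isoY x y : dY (iota x) (iota y) = E x y. Proof. by case: cY => _ [_ []]. Qed.
Let denseY y e : 0 < e -> exists x, dY (iota x) y < e.
Proof. by case: cY => _ [_ [_]]; exact. Qed.
Let rho0 x : 0 < rho x := rho_gt0 D z0 eps x.

Lemma d_eps_sym x y : E x y = E y x.
Proof. by rewrite -!isoY is_metric_sym. Qed.

Lemma d_eps_tri y x z : E x z <= E x y + E y z.
Proof. by rewrite -!isoY; exact: is_metric_tri. Qed.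

(** If [w] were closer, [rho_lipschitz] would keep [rho] bounded below at points near [w]. There
    [dist_le_d_eps] makes a sequence tending to [w] Cauchy for [D], and its [D]-limit would be a
    point of the space mapped to [w]. *)
Lemma bdry_dist_ge x w : mcomplete D -> bdry iota w -> rho x / eps <= dY (iota x) w.
Proof.
move=> completeD bw; rewrite leNgt; apply/negP; rewrite ltr_pdivlMr// mulrC => xw.
set k := rho x - eps * dY (iota x) w.
have k0 : 0 < k by rewrite /k; lra.
have rhok p : dY (iota p) w < k / (2 * eps) -> k / 2 <= rho p.
  rewrite ltr_pdivlMr ?mulr_gt0// => pw.
  have := rho_lipschitz z0 mD gD eps_gt0 x p; rewrite -isoY.
  have := ler_wpM2l (ltW eps_gt0) (is_metric_tri mY w (iota x) (iota p)).
  by rewrite (is_metric_sym mY w) /k in pw *; lra.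
have near n : exists p, dY (iota p) w < Num.min (k / (2 * eps)) n.+1%:R^-1.
  apply: denseY.
  by rewrite lt_min !divr_gt0 ?mulr_gt0// invr_gt0 ltr0n.
have [u uP] := choice near.
have uk n : k / 2 <= rho (u n).
  by apply: rhok; have := uP n; rewrite lt_min => /andP[].
have un n : dY (iota (u n)) w < n.+1%:R^-1.
  by have := uP n; rewrite lt_min => /andP[].
have [e e0|p pP] := completeD u.
  (* The first bound is what [dist_le_d_eps] requires; the second makes [2 * c] at most
     [eps * e / 2]. *)
  pose c := Num.min 2^-1 (eps * e / 4).
  have c0 : 0 < c by rewrite lt_min invr_gt0 ltr0n !mulr_gt0// invr_gt0.
  have [N NP] : exists N, forall n, (N <= n)%N -> n.+1%:R^-1 < c * k / (4 * eps).
    by apply: invS_lt; rewrite divr_gt0 ?mulr_gt0.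
  exists N => m n Nm Nn.
  have : eps * D (u m) (u n) <= 2 * c.
    apply: (dist_le_d_eps mD gD eps_gt0); last by rewrite /c ge_min lexx.
    have := is_metric_tri mY w (iota (u m)) (iota (u n)); rewrite isoY (is_metric_sym mY w).
    move: (lt_trans (un m) (NP m Nm)) (lt_trans (un n) (NP n Nn)).
    rewrite !ltr_pdivlMr ?mulr_gt0// => hm hn ht.
    have := ler_wpM2l (ltW eps_gt0) ht; have := ler_wpM2l (ltW c0) (uk m); lra.
  have : c <= eps * e / 4 by rewrite /c ge_min lexx orbT.
  move=> ce De; rewrite -(ltr_pM2l eps_gt0).
  have := mulr_gt0 eps_gt0 e0; lra.
apply: bw; exists p => //; apply: (is_metric_eq0 mY); apply/eqP.
rewrite eq_le is_metric_ge0// andbT; apply/ler_addgt0Pl => e e0.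
have e20 : 0 < e / 2 by rewrite divr_gt0.
have [N1 N1P] := pP _ e20; have [N2 N2P] := invS_lt e20.
pose n := maxn N1 N2.
have := N1P n (leq_maxl _ _); have := lt_trans (un n) (N2P n (leq_maxr _ _)).
have := d_eps_le_dist z0 mD gD eps_gt0 (u n) p; rewrite -isoY (is_metric_sym mY (iota (u n))).
have := is_metric_tri mY (iota (u n)) (iota p) w; lra.
Qed.

(** By [d_eps_radial] the part of the ray beyond [g s] stays within [rho (g s) / eps] of [g s], so
    the ray converges in the completion. The limit is a boundary point: [rho] tends to [0] along the
    ray, whereas it is positive and Lipschitz near any point of the space. *)
Lemma ray_bdry g t : geodesic_ray D g z0 -> 0 <= t ->
  exists2 w, bdry iota w & dY (iota (g t)) w <= rho (g t) / eps.
Proof.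
move=> [g0 [geo unb]] t0.
have add s t' : 0 <= s -> s <= t' -> D z0 (g t') = D z0 (g s) + D (g s) (g t').
  move=> s0 st'; rewrite -{1 2}g0; apply: esym.
  by apply: (geodesic_additive mD (geo t' (le_trans s0 st'))).
have tail s t' : 0 <= s -> s <= t' -> E (g s) (g t') <= rho (g s) / eps.
  move=> s0 st'; apply: le_trans (d_eps_radial mD gD eps_gt0 (add s t' s0 st')) _.
  by rewrite ler_pM2r ?invr_gt0//; have := rho0 (g t'); lra.
have far n : exists s, 0 <= s /\ n%:R < D z0 (g s).
  by have [s s0] := unb n%:R; rewrite g0 => ns; exists s.
have [k kP] := choice far.
have k0 n : 0 <= k n by case: (kP n).
have kn n : n%:R < D z0 (g (k n)) by case: (kP n).
have rhok N n : (N <= n)%N -> rho (g (k n)) <= expR (- (eps * N%:R)).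
  move=> Nn; rewrite ler_expR lerN2 ler_pM2l// (is_metric_sym mD).
  by apply: le_trans (ltW (kn n)); rewrite ler_nat.
have small e : 0 < e -> exists N, expR (- (eps * N%:R)) < e.
  move=> e0; exists (Num.truncn (eps^-1 * e^-1)).+1; apply: expRN_lt => //.
  by rewrite -ler_pdivrMl//; apply: ltW; exact: truncnS_gt.
have [_ [completeY _]] := cY.
have [e e0|w wP] := completeY (fun n => iota (g (k n))).
  have [N NP] : exists N, expR (- (eps * N%:R)) < eps * e.
    by apply: small; rewrite mulr_gt0.
  exists N => m n Nm Nn; rewrite isoY.
  have main i j : (N <= i)%N -> k i <= k j -> E (g (k i)) (g (k j)) < e.
    move=> Ni ij; apply: le_lt_trans (tail _ _ (k0 i) ij) _.
    by rewrite ltr_pdivrMr// mulrC; exact: le_lt_trans (rhok N i Ni) NP.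
  have [mn|nm] := leP (k m) (k n); first exact: main.
  by rewrite d_eps_sym; apply: main => //; exact: ltW.
exists w.
  move=> [p _ pw].
  have rp := rho0 p.
  have r20 : 0 < rho p / 2 by rewrite divr_gt0.
  have [N1 N1P] := small _ r20.
  have [|N2 N2P] := wP (rho p / (2 * eps)); first by rewrite divr_gt0 ?mulr_gt0.
  pose n := maxn N1 N2.
  have := N2P n (leq_maxr _ _); rewrite -pw isoY d_eps_sym.
  rewrite ltr_pdivlMr ?mulr_gt0//.
  have := rhok N1 n (leq_maxl _ _).
  have := rho_lipschitz z0 mD gD eps_gt0 p (g (k n)); lra.
apply/ler_addgt0Pr => e e0.
have [N NP] := wP e e0.
(* This [n] exceeds [D z0 (g t)]; distance to [z0] is monotone along the ray, so [g (k n)] comes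
   after [g t]. *)
pose n := maxn N (Num.truncn (D z0 (g t))).+1.
have tn : t <= k n.
  rewrite leNgt; apply/negP => nt.
  have := add (k n) t (k0 n) (ltW nt).
  have := is_metric_ge0 mD (g (k n)) (g t); have := kn n.
  have : (Num.truncn (D z0 (g t))).+1%:R <= n%:R :> R by rewrite ler_nat leq_maxr.
  have := truncnS_gt (D z0 (g t)); lra.
have := NP n (leq_maxl _ _); have := tail t (k n) t0 tn; rewrite -isoY.
have := is_metric_tri mY (iota (g (k n))) (iota (g t)) w; lra.
Qed.

(** Bounds the ratio of the boundary distance to [rho]: [M + 1] pays for the way to a ray, [eps^-1]
    for following the ray to infinity, and the exponential for the change of [rho] on the way to the
    ray. The added [1] is slack, as [dist_le] gives no point at distance exactly [M]. *)
Definition whitney_const M := expR (eps * (M + 1)) * (M + 1 + eps^-1).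

Lemma bdry_dist_le M x : roughly_starlike D z0 M ->
  exists2 w, bdry iota w & dY (iota x) w <= whitney_const M * rho x.
Proof.
move=> [M0 star]; have [g [ray near]] := star x.
have [_ [t t0 <-] xq] := near 1 ltr01; rewrite /= in t0.
have [w bw qw] := ray_bdry ray t0; exists w => //.
apply: le_trans (is_metric_tri mY (iota (g t)) _ _) _; rewrite isoY.
set q := g t in xq qw *.
have xq0 := is_metric_ge0 mD x q.
set c := expR (eps * (M + 1)).
have cD : expR (eps * D x q) <= c by rewrite ler_expR ler_pM2l// ltW.
have -> : whitney_const M * rho x = c * rho x * (M + 1) + c * rho x / eps.
  by rewrite /whitney_const -/c; ring.
apply: lerD.
  apply: le_trans (d_eps_le z0 mD gD eps_gt0 x q) _.
  by rewrite ler_pM ?mulr_ge0 ?expR_ge0 ?(ltW (rho0 x)) ?(ltW xq)// ler_pM2r.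
apply: le_trans qw _; rewrite ler_pM2r ?invr_gt0//.
by apply: le_trans (rho_harnack z0 mD eps_gt0 x q) _; rewrite ler_pM2r.
Qed.

Lemma base_dist_le y : dY (iota z0) y <= eps^-1.
Proof.
apply/ler_addgt0Pr => e e0; have [x xy] := denseY y e0.
apply: le_trans (is_metric_tri mY (iota x) _ _) _; rewrite isoY lerD ?(ltW xy)//.
have : D z0 x = D z0 z0 + D z0 x by rewrite is_metric_refl// add0r.
move=> /(d_eps_radial mD gD eps_gt0) /le_trans; apply.
rewrite rho_base// ler_pdivrMr// mulVf ?gt_eqF//; have := rho0 x; lra.
Qed.

Lemma completion_dist_le y y' : dY y y' <= 2 / eps.
Proof.
have := base_dist_le y; have := base_dist_le y'.
have := is_metric_tri mY (iota z0) y y'; rewrite (is_metric_sym mY y (iota z0)); lra.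
Qed.

Lemma diam_d_eps_le : diam E <= 2 / eps.
Proof.
apply: ge_sup; first by exists (E z0 z0); exists z0 => //; exists z0.
by move=> _ [x _ [y _ <-]]; rewrite -isoY completion_dist_le.
Qed.

Lemma completion_dist_le_diam y y' : dY y y' <= diam E.
Proof.
apply/ler_addgt0Pr => e e0.
have e20 : 0 < e / 2 by rewrite divr_gt0.
have [x xy] := denseY y e20; have [x' xy'] := denseY y' e20.
have : E x x' <= diam E.
  apply: ub_le_sup; last by exists x => //; exists x'.
  by exists (2 / eps) => _ [p _ [q _ <-]]; rewrite -isoY completion_dist_le.
rewrite -isoY.
have := is_metric_tri mY (iota x) y y'; have := is_metric_tri mY (iota x') (iota x) y'.
rewrite (is_metric_sym mY y (iota x)); lra.
Qed.

Lemma diam_d_eps_gt0 : munbounded D -> 0 < diam E.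
Proof.
move=> unb; have [y y0] := unb z0 0.
apply: lt_le_trans (completion_dist_le_diam (iota z0) (iota y)).
rewrite isoY; apply: lt_le_trans (d_eps_ge z0 mD gD eps_gt0 z0 y).
rewrite divr_gt0// mulr_gt0// subr_gt0 -expR0 ltr_expR oppr_lt0.
exact: mulr_gt0.
Qed.

(** * Consequences of uniformity *)

Section Uniform.
Context (A : R).
Hypothesis uA : uniform_space E dY iota A.

(** The sign of [A] is not part of [uniform_space]. It follows from two points at positive distance,
    because a curve is at least as long as the distance of its ends. *)
Lemma uniform_const_ge1 : munbounded D -> 1 <= A.
Proof.
move=> unb; have [y y0] := unb z0 0.
have [g [l [ag g0 gl lA _]]] := uA.2 z0 y.
have l0 : 0 <= l by case: ag => [[]].
have := arclength_dist ag (lexx 0) l0 (lexx l); rewrite g0 gl subr0 => El.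
have E0 : 0 < E z0 y.
  apply: lt_le_trans (d_eps_ge z0 mD gD eps_gt0 z0 y).
  rewrite divr_gt0// mulr_gt0// subr_gt0 -expR0 ltr_expR oppr_lt0.
  exact: mulr_gt0.
by rewrite -(ler_pM2r E0) mul1r (le_trans El).
Qed.

(** If [z0] is well inside the ball, it serves as center, being at distance at least
    [eps^-1 >= r / 4] from the boundary. Otherwise a uniform curve from a point near [x] to [z0] is
    longer than [2 * r / 3], and a point on its first half is deep enough. *)
Lemma corkscrew a0 x r : mcomplete D -> 0 < a0 -> a0 < 1 / 8 -> a0 < 1 / (6 * A) ->
  0 < r -> r <= 2 * diam E ->
  exists z, mball dY (iota z) (a0 * r) `<=` mball dY x r /\
    forall w, bdry iota w -> 2 * a0 * r <= dY (iota z) w.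
Proof.
move=> completeD a00 a8 aA r0 rd.
have A0 : 0 < A.
  have : 0 < 1 / (6 * A) by exact: lt_trans aA.
  by rewrite div1r invr_gt0 pmulr_rgt0.
have ar : a0 * r < r / 8 by rewrite mulrC ltr_pM2l//; lra.
have reps : r / 4 <= eps^-1 by have := diam_d_eps_le; lra.
have sub z : dY x (iota z) <= r - a0 * r ->
    mball dY (iota z) (a0 * r) `<=` mball dY x r.
  move=> xz y; rewrite /mball /= => zy.
  have := is_metric_tri mY (iota z) x y; lra.
have [xz0|xz0] := leP (dY x (iota z0)) (r - a0 * r).
  exists z0; split; first exact: sub.
  move=> w /(bdry_dist_ge z0 completeD); rewrite rho_base// div1r; lra.
have r10 : 0 < r / 10 by rewrite divr_gt0.
have [x' xx'] := denseY x r10.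
have [g [l [ag g0 gl lA far]]] := uA.2 x' z0.
have l0 : 0 <= l by case: ag => [[]].
have := arclength_dist ag (lexx 0) l0 (lexx l); rewrite g0 gl subr0 => El.
have := is_metric_tri mY (iota x') x (iota z0).
rewrite (is_metric_sym mY x (iota x')) isoY => xz0'.
have lr : 2 * r / 3 <= l by lra.
have r3 : 0 <= r / 3 by lra.
have r3l : r / 3 <= l by lra.
(* At parameter [r / 3] the depth is at least [r / (3 * A)], which exceeds [2 * a0 * r] because
   [a0 < 1 / (6 * A)]. *)
exists (g (r / 3)); split.
  apply: sub.
  have := arclength_dist ag (lexx 0) r3 r3l; rewrite g0 subr0 -isoY.
  have := is_metric_tri mY (iota x') x (iota (g (r / 3))).
  rewrite (is_metric_sym mY x (iota x')); lra.
move=> w bw; apply: le_trans (far (r / 3) _ w bw); last by rewrite r3 r3l.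
have -> : Num.min (r / 3) (l - r / 3) = r / 3 by apply/min_idPl; lra.
rewrite ler_pdivlMr//; move: aA; rewrite ltr_pdivlMr ?mulr_gt0// => aA.
have := ltW aA; rewrite -(ler_pM2r r0); lra.
Qed.

(** A uniform curve from [p] to [q] stays at distance at least [k / (2 * A)] from the boundary: near
    its ends by the triangle inequality, elsewhere by uniformity. This bounds [rho] from below, so
    each piece of length [k / (4 * A * whitney_const M * eps)] has [D]-size at most [eps^-1]. *)
Lemma uniform_dist_le M p q k L n : munbounded D -> roughly_starlike D z0 M -> 0 < k ->
  (forall w, bdry iota w -> k <= dY (iota p) w) ->
  (forall w, bdry iota w -> k <= dY (iota q) w) ->
  E p q <= L -> A * L <= n%:R * (k / (4 * A * whitney_const M * eps)) ->
  D p q <= n%:R / eps.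
Proof.
move=> unb star k0 kp kq pqL Ln; have A1 := uniform_const_ge1 unb.
have A0 : 0 < A by lra.
set C0 := whitney_const M in Ln *.
have C00 : 0 < C0.
  case: star => M0 _; rewrite /C0 /whitney_const mulr_gt0 ?expR_gt0//.
  by rewrite !addr_gt0// invr_gt0.
have [g [l [ag g0 gl lA far]]] := uA.2 p q.
have l0 : 0 <= l by case: ag => [[]].
have kA : k / (2 * A) <= k / 2.
  by rewrite ler_pM2l// lef_pV2 ?posrE ?mulr_gt0//; lra.
have deep t w : 0 <= t <= l -> bdry iota w -> k / (2 * A) <= dY (iota (g t)) w.
  move=> /andP[t0 tl] bw.
  have [tk|kt] := leP t (k / 2).
    apply: le_trans kA _.
    have := arclength_dist ag (lexx 0) t0 tl; rewrite g0 subr0 -isoY.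
    have := is_metric_tri mY (iota (g t)) (iota p) w; have := kp w bw; lra.
  have [ltk|klt] := leP (l - t) (k / 2).
    apply: le_trans kA _.
    have := arclength_dist ag t0 tl (lexx l); rewrite gl -isoY (is_metric_sym mY (iota (g t))).
    have := is_metric_tri mY (iota (g t)) (iota q) w; have := kq w bw; lra.
  apply: le_trans (far t _ w bw); last by rewrite t0 tl.
  by rewrite invfM mulrA ler_pM2r ?invr_gt0// le_min !ltW.
have H0 : 0 < 4 * A * C0 * eps.
  apply: mulr_gt0 => //; apply: mulr_gt0 => //; exact: mulr_gt0.
rewrite -g0 -gl -[_ / eps]/(n%:R * eps^-1).
apply: (chain_dist mD (h := k / (4 * A * C0 * eps))) => //.
- exact: ltW (divr_gt0 k0 H0).
- by rewrite invr_ge0 ltW.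
- by apply: le_trans Ln; apply: le_trans lA _; rewrite ler_pM2l.
move=> s t s0 st tl; rewrite ler_pdivlMr// => sth.
rewrite -(ler_pM2l eps_gt0) mulfV ?gt_eqF//.
have -> : 1 = 2 * 2^-1 :> R by rewrite mulfV.
apply: (dist_le_d_eps mD gD eps_gt0) => //.
have [w bw ww] := bdry_dist_le (g s) star.
have := deep s w; rewrite s0 (le_trans st tl) => /(_ isT bw) dw.
have : k / (2 * A) <= C0 * rho (g s) by exact: le_trans ww.
rewrite ler_pdivrMr ?mulr_gt0// => kC.
have := arclength_dist ag s0 st tl => Est.
have AC : 0 < 2 * A * C0 by apply: mulr_gt0 => //; exact: mulr_gt0.
rewrite -(ler_pM2l AC).
have H : E (g s) (g t) * (4 * A * C0 * eps) <= (t - s) * (4 * A * C0 * eps).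
  by rewrite ler_pM2r.
lra.
Qed.

(* The points of the ball [E y z < L r] lie, up to a bounded error, behind [z] as seen
   from [z0]: climb from [y] towards [z0] up to height [rho = eps r / 4], and join the
   point reached to [z] by a uniform curve. *)
Lemma ball_behind_center M a0 L r n y z : mcomplete D -> munbounded D ->
  roughly_starlike D z0 M -> 0 < a0 -> a0 <= 1 / 8 -> 0 < r -> r <= 4 / eps ->
  (forall w, bdry iota w -> 2 * a0 * r <= dY (iota z) w) -> E y z <= L * r ->
  A * (L + 1) <= n%:R * (a0 / (2 * A * whitney_const M * eps)) ->
  D z z0 + D y z <= D y z0 + 2 * n%:R / eps.
Proof.
move=> completeD unb star a00 a8 r0 reps deepz yzL nL.
have A1 := uniform_const_ge1 unb.
have A0 : 0 < A by lra.
suff [y' [ry' yy' eq]] : exists y', [/\ eps * r / 4 <= rho y', E y y' <= r / 4 &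
    D y z0 = D y y' + D y' z0].
  have y'z : D y' z <= n%:R / eps.
    (* The height [eps * r / 4] puts [y'] at distance at least [r / 4 >= 2 * a0 * r] from the
       boundary; the [1] in [L + 1] absorbs [E y y']. *)
    apply: (uniform_dist_le (M := M) (k := 2 * a0 * r) (L := (L + 1) * r)) => //.
    - by rewrite !mulr_gt0.
    - move=> w bw; apply: le_trans (bdry_dist_ge y' completeD bw).
      rewrite ler_pdivlMr//; apply: le_trans ry'.
      have := mulr_gt0 r0 eps_gt0; nra.
    - have := d_eps_tri y y' z; rewrite (d_eps_sym y' y); lra.
    - move: nL; rewrite -(ler_pM2r r0); congr (_ <= _); first by ring.
      case: star => M0 _.
      have : whitney_const M != 0.
        by rewrite gt_eqF// mulr_gt0 ?expR_gt0// !addr_gt0// invr_gt0.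
      by move=> W0; field; rewrite W0 !gt_eqF.
  have := is_metric_tri mD y' y z; have := is_metric_tri mD y' z z0.
  by rewrite (is_metric_sym mD z y') eq; lra.
have b0 : 0 < eps * r / 4 by rewrite !mulr_gt0// invr_gt0.
have b1 : eps * r / 4 <= 1.
  by move: reps; rewrite ler_pdivlMr// mulrC; lra.
have [ry|yr] := leP (eps * r / 4) (rho y).
  exists y; split => //; last by rewrite is_metric_refl// add0r.
  by apply: le_trans (d_eps_le_dist z0 mD gD eps_gt0 y y) _; rewrite is_metric_refl//; lra.
(* The distance from [z0] at which [rho] equals [eps * r / 4]; it is nonnegative because
   [r <= 4 / eps]. *)
pose t := - ln (eps * r / 4) / eps.
have et : eps * t = - ln (eps * r / 4) by rewrite /t mulrC divfK// gt_eqF.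
have t0 : 0 <= t by rewrite divr_ge0 ?(ltW eps_gt0)// oppr_ge0 ln_le0.
have ty : t <= D z0 y.
  rewrite -(ler_pM2l eps_gt0) et lerNl -ler_expR lnK ?posrE//.
  by rewrite (is_metric_sym mD z0); exact: ltW.
have [g [g0 g1 ag gt]] := geodesic_arclength mD gD z0 y.
have [|d1 d2] := gt t; first by rewrite t0 ty.
have rg : rho (g t) = eps * r / 4.
  by rewrite /rho_eps (is_metric_sym mD) d1 et opprK lnK ?posrE.
exists (g t); split; first by rewrite rg.
  rewrite d_eps_sym; apply: le_trans (d_eps_radial mD gD eps_gt0 _) _.
    by rewrite d1 d2; ring.
  rewrite rg ler_pdivrMr//; have := rho0 y; lra.
by rewrite (is_metric_sym mD y z0) (is_metric_sym mD y) d2 (is_metric_sym mD (g t)) d1 subrK.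
Qed.

End Uniform.

End UniformizedBoundary.

(** * Separated sets, and growth of balls for a measure doubling at small scales *)

Lemma exists_max_separated (R : realType) (T : choiceType) (D : T -> T -> R) (c : R)
  (P : pred T) N :
  (forall s, all P s -> pairwise (fun p q => c <= D p q) s -> (size s <= N)%N) ->
  exists s, [/\ all P s, pairwise (fun p q => c <= D p q) s &
    forall y, P y -> exists2 p, p \in s & D y p < c].
Proof.
move=> bound.
pose Q n := `[< exists s, [/\ size s = n, all P s & pairwise (fun p q => c <= D p q) s] >].
have exQ : exists n, Q n by exists 0%N; apply/asboolP; exists [::].
have ubQ n : Q n -> (n <= N)%N.
  by move=> /asboolP[s [<- Ps ss]]; exact: bound.
case: (ex_maxnP exQ ubQ) => n /asboolP[s [sn Ps ss]] maxn.
(* A point far from all entries of a longest separated list could be added to it. *)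
exists s; split => // y Py; apply: contrapT => far.
have : Q n.+1.
  apply/asboolP; exists (y :: s); split => /=; [by rewrite sn|by rewrite Py|].
  rewrite ss andbT; apply/allP => p ps; rewrite leNgt; apply/negP => yp.
  by apply: far; exists p.
by move=> /maxn; rewrite ltnn.
Qed.

Section LocalDoubling.
Context {R : realType} (d : measure_display) (T : measurableType d).
Context (D : T -> T -> R) (mu : {measure set T -> \bar R}) (R0 Cd : R).
Hypothesis mD : is_metric D.
Hypothesis gD : geodesic_space D.
Hypothesis bD : borel_measurable D.
Hypothesis R00 : 0 < R0.
Hypothesis dbl : doubling_upto D mu R0 Cd.

Notation B := (mball D).

Lemma measurable_mopen U : mopen D U -> measurable U.
Proof. by move=> oU; rewrite bD; exact: sub_sigma_algebra. Qed.

Lemma measurable_mball x r : measurable (B x r).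
Proof. exact/measurable_mopen/mopen_mball. Qed.

Let mB := measurable_mball.

Lemma le_mu (U V : set T) : measurable U -> measurable V -> U `<=` V -> (mu U <= mu V)%E.
Proof. by move=> mU mV UV; apply: le_measure; rewrite ?inE. Qed.

Lemma mball_gt0 x r : 0 < r -> r <= 2 * R0 -> (0 < mu (B x r))%E.
Proof.
move=> r0 rR; have [] := @dbl x (r / 2); [lra|lra|].
by have -> : 2 * (r / 2) = r by field.
Qed.

Lemma mball_fin x r : 0 < r -> r <= R0 -> mu (B x r) \is a fin_num.
Proof. by move=> r0 rR; rewrite ge0_fin_numE//; have [] := @dbl x r r0 rR. Qed.

Lemma doubling_const_ge1 : 1 <= Cd.
Proof.
have [x] : exists x : T, True by exists point.
move=> _; have R1 := R00; have [_ H _] := @dbl x R0 R00 (lexx _).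
have m0 : (0 < mu (B x R0))%E by apply: mball_gt0; lra.
have f := mball_fin x R00 (lexx _).
have : (mu (B x R0) <= Cd%:E * mu (B x R0))%E.
  apply: le_trans H; apply: le_mu => // y; rewrite /mball /=; lra.
rewrite -(fineK f) -EFinM lee_fin; rewrite -(fineK f) lte_fin in m0.
by rewrite -{1}(mul1r (fine _)) ler_pM2r.
Qed.

Lemma doubling_iter k x s1 s2 : 0 < s1 -> s1 <= 2 * R0 -> s1 <= 2 ^+ k * s2 ->
  (mu (B x s1) <= (Cd ^+ k)%:E * mu (B x s2))%E.
Proof.
have C1 := doubling_const_ge1.
elim: k s1 => [|k IH] s1 s10 s1R s12.
  rewrite !expr0 mul1e mul1r in s12 *; apply: le_mu => // y; rewrite /mball /=; lra.
have [h1 h2] : 0 < s1 / 2 /\ s1 / 2 <= R0 by split; lra.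
have [_ H _] := @dbl x (s1 / 2) h1 h2.
have e : 2 * (s1 / 2) = s1 by field.
rewrite e in H; apply: le_trans H _.
rewrite exprS EFinM -muleA; apply: lee_wpmul2l; first by rewrite lee_fin; lra.
by apply: IH; [lra|lra|rewrite exprS in s12; lra].
Qed.

(** Walk from [x] to [p] along a geodesic in [n.+1] steps shorter than [t]. Each step costs one
    factor [Cd], since the ball about the old center lies in the doubled ball about the new one. *)
Lemma mball_chain n x p t : 0 < t -> t <= R0 -> D x p < n.+1%:R * t ->
  (mu (B x t) <= (Cd ^+ n.+1)%:E * mu (B p t))%E.
Proof.
have C1 := doubling_const_ge1.
move=> t0 tR; elim: n x => [|n IH] x; first last.
  have -> : n.+2%:R * t = t + n.+1%:R * t by rewrite -(natr1 n.+1); ring.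
  move=> /(geodesic_split mD gD t0) -/(_ (mulr_gt0 (ltr0Sn _ _) t0)) [q xq /IH qp].
  have := @doubling_iter 1%N q (2 * t) t.
  rewrite expr1 => /(_ _ _ _)/le_trans H.
  rewrite exprS EFinM -muleA; apply: le_trans (_ : (_ <= Cd%:E * mu (B q t))%E) _.
    apply: le_trans (H _ _ _ _ (lexx _)); [|lra|lra|lra].
    apply: le_mu => // y; rewrite /mball /= => xy.
    have := is_metric_tri mD x q y; rewrite (is_metric_sym mD q x); lra.
  by apply: lee_wpmul2l; first by rewrite lee_fin; lra.
rewrite mul1r expr1 => xp.
have := @doubling_iter 1%N p (2 * t) t.
rewrite expr1 => /(_ _ _ _)/le_trans H.
apply: le_trans (H _ _ _ _ (lexx _)); [|lra|lra|lra].
apply: le_mu => // y; rewrite /mball /= => xy.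
have := is_metric_tri mD x p y; rewrite (is_metric_sym mD p x); lra.
Qed.

Lemma sum_disjoint_mball (s : seq T) t U : measurable U ->
  {in s, forall p, B p t `<=` U} -> pairwise (fun p q => 2 * t <= D p q) s ->
  (\sum_(p <- s) mu (B p t) <= mu U)%E.
Proof.
elim: s U => [|p s IH] U mU sU; first by rewrite big_nil.
rewrite /= => /andP[/allP ps ss]; rewrite big_cons.
rewrite (measureDI mu mU (mB p t)) addeC.
have -> : U `&` B p t = B p t.
  by apply/setIidPr; apply: sU; rewrite inE eqxx.
apply: leeD => //; apply: IH => //; first exact: measurableD.
move=> q qs y qy; split; first by apply: (sU q) => //; rewrite inE qs orbT.
move: qy; rewrite /mball /= => qy py; have := ps q qs.
have := is_metric_tri mD y p q; rewrite (is_metric_sym mD y q); lra.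
Qed.

Lemma mu_cover_le (s : seq T) t V : measurable V ->
  (forall y, V y -> exists2 p, p \in s & B p t y) ->
  (mu V <= \sum_(p <- s) mu (B p t))%E.
Proof.
elim: s V => [|p s IH] V mV cov.
  have -> : V = set0 by apply/seteqP; split => // y /cov[].
  by rewrite measure0 big_nil.
rewrite big_cons (measureDI mu mV (mB p t)) addeC; apply: leeD.
  by apply: le_mu => //; exact: measurableI.
apply: IH; first exact: measurableD.
move=> y [Vy npy]; have [q] := cov y Vy.
by rewrite inE => /predU1P[->//|qs qy]; exists q.
Qed.

(** Take a maximal [R0]-separated set in [B x (r - R0 / 2)]. The balls of radius [R0 / 2] about its
    points are disjoint and lie in [B x r]; those of radius [2 * R0] cover [B x (r + R0 / 2)]. Two
    doublings relate the radii. *)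
Lemma mball_growth_step x r : R0 <= r -> mu (B x r) \is a fin_num ->
  (mu (B x (r + R0 / 2)) <= (Cd ^+ 2)%:E * mu (B x r))%E.
Proof.
move=> Rr fr; have C1 := doubling_const_ge1.
have R1 := R00; pose t := R0 / 2; have t0 : 0 < t by rewrite /t; lra.
have tR : t <= R0 by rewrite /t; lra.
pose m := fine (mu (B x t)).
have fm := mball_fin x t0 tR.
have m0 : 0 < m.
  by rewrite -lte_fin /m fineK//; apply: mball_gt0 => //; rewrite /t; lra.
pose n := Num.truncn (r / t).
pose P := [pred p | D x p < r - t].
have Cn0 : 0 < Cd ^+ n.+1 by apply: exprn_gt0; lra.
(* This only bounds the size of a separated list, so a constant that depends on [r] is harmless. *)
have lower p : P p -> ((m / Cd ^+ n.+1)%:E <= mu (B p t))%E.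
  move=> /= xp; have := @mball_chain n x p t t0 tR.
  have : r < n.+1%:R * t by rewrite -ltr_pdivrMr//; exact: truncnS_gt.
  move=> rn; have xn : D x p < n.+1%:R * t by lra.
  move=> /(_ xn).
  rewrite -(fineK fm) -/m -(fineK (mball_fin p t0 tR)) -EFinM !lee_fin.
  by rewrite ler_pdivrMr// mulrC.
have inB p : P p -> B p t `<=` B x r.
  move=> /= xp y; rewrite /mball /= => py; have := is_metric_tri mD p x y; lra.
have sumle s : all P s -> pairwise (fun p q => 2 * t <= D p q) s ->
    (\sum_(p <- s) mu (B p t) <= mu (B x r))%E.
  move=> /allP sP ss; apply: sum_disjoint_mball => // p ps; exact/inB/sP.
have [s [sP ss cov]] : exists s, [/\ all P s, pairwise (fun p q => 2 * t <= D p q) s &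
    forall y, P y -> exists2 p, p \in s & D y p < 2 * t].
  apply: (@exists_max_separated _ _ _ _ _ (Num.truncn (fine (mu (B x r)) / (m / Cd ^+ n.+1)))).
  move=> s sP ss; have := sumle s sP ss; rewrite -(fineK fr) => le1.
  have le2 : (((size s)%:R * (m / Cd ^+ n.+1))%:E <= \sum_(p <- s) mu (B p t))%E.
    move: sP {ss le1}; elim: s => [|p s IH] /=; first by rewrite mul0r big_nil.
    move=> /andP[pP /IH sP]; rewrite big_cons -natr1 mulrDl mul1r addrC EFinD.
    by apply: leeD => //; exact: lower.
  have := le_trans le2 le1; rewrite lee_fin -ler_pdivlMr ?divr_gt0//.
  by move=> H; rewrite truncn_ge_nat// (le_trans _ H).
apply: le_trans (_ : (_ <= \sum_(p <- s) mu (B p (4 * t)))%E) _.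
  apply: mu_cover_le => // y; rewrite /mball /= => xy.
  have [|||y' xy' y'y] := @geodesic_split _ _ D mD gD x y (r - t) (2 * t).
  - by rewrite /t; lra.
  - by rewrite /t; lra.
  - by rewrite /t; move: xy; lra.
  have [p ps y'p] := cov y' xy'; exists p => //.
  have := is_metric_tri mD y' p y; rewrite (is_metric_sym mD p y'); lra.
apply: le_trans (_ : (_ <= \sum_(p <- s) (Cd ^+ 2)%:E * mu (B p t))%E) _.
  apply: lee_sum => p _; apply: doubling_iter; rewrite /t; lra.
rewrite -ge0_sume_distrr//; apply: lee_wpmul2l; last exact: sumle.
by rewrite lee_fin exprn_ge0//; lra.
Qed.

(** Finiteness is part of the induction: doubling gives it up to radius [R0], and each growth step
    passes it on. *)
Lemma mball_growth n x : mu (B x (R0 + n%:R * (R0 / 2))) \is a fin_num /\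
  (mu (B x (R0 + n%:R * (R0 / 2))) <= (Cd ^+ 2 ^+ n)%:E * mu (B x R0))%E.
Proof.
have C1 := doubling_const_ge1.
have fR := mball_fin x R00 (lexx _).
elim: n => [|n [IHf IH]]; first by rewrite mul0r addr0 expr0 mul1e.
have -> : R0 + n.+1%:R * (R0 / 2) = R0 + n%:R * (R0 / 2) + R0 / 2.
  by rewrite -natr1; ring.
have step := @mball_growth_step x (R0 + n%:R * (R0 / 2)) _ IHf.
have {}step : (mu (B x (R0 + n%:R * (R0 / 2) + R0 / 2)) <=
    (Cd ^+ 2)%:E * mu (B x (R0 + n%:R * (R0 / 2))))%E.
  by apply: step; rewrite lerDl mulr_ge0// divr_ge0// ltW.
split.
  rewrite ge0_fin_numE//; apply: le_lt_trans step _.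
  by rewrite -(fineK IHf) -EFinM ltry.
apply: le_trans step _; rewrite (exprS (Cd ^+ 2)) (EFinM (Cd ^+ 2)) -muleA.
by apply: lee_wpmul2l; rewrite ?lee_fin ?exprn_ge0//; lra.
Qed.

Lemma measurable_dist z : measurable_fun setT (fun y => D y z).
Proof.
apply: (measurability _ (RGenInftyO.measurableE R)) => _ [_ [a ->] <-].
rewrite setTI; apply: measurable_mopen => y /=; rewrite in_itv /= => ya.
exists (a - D y z); first by rewrite subr_gt0.
move=> y'; rewrite /mball /= in_itv /= => yy'.
have := is_metric_tri mD y y' z; rewrite (is_metric_sym mD y' y); lra.
Qed.

Lemma measurable_exp_dist b z (U : set T) :
  measurable_fun U (fun y => (expR (- (b * D y z)))%:E).
Proof.
apply/measurable_EFinP; apply: measurable_funTS.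
apply: (measurableT_comp (f := expR)) => //.
apply: measurableT_comp => //; apply: measurable_funM => //.
exact: measurable_dist.
Qed.

Lemma geometric_sum_le (q : R) n : 0 <= q -> q < 1 -> \sum_(i < n) q ^+ i <= (1 - q)^-1.
Proof.
move=> q0 q1; have q10 : 0 < 1 - q by lra.
rewrite -(ler_pM2l q10) mulfV ?gt_eqF// -[leLHS]opprK -mulNr opprB -subrX1 opprB.
by rewrite gerBl exprn_ge0.
Qed.

(** For [n] the integer part of [D y x / t], the term [f n y] alone dominates the integrand at [y].
    By [mball_growth] the [n]-th integral is at most [q ^+ n] times the measure of [B x R0], and the
    geometric series converges. *)
Lemma integral_exp_dist_le b x : 0 <= b -> expR (- (b * (R0 / 2))) * Cd ^+ 2 < 1 ->
  (\int[mu]_y (expR (- (b * D y x)))%:E <=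
   ((1 - expR (- (b * (R0 / 2))) * Cd ^+ 2)^-1)%:E * mu (B x R0))%E.
Proof.
move=> b0; set t := R0 / 2; set q := _ * _ => q1.
have t0 : 0 < t by rewrite divr_gt0.
have C1 := doubling_const_ge1.
have q0 : 0 <= q by rewrite mulr_ge0 ?expR_ge0 ?exprn_ge0//; lra.
pose f n y : \bar R := ((expR (- (b * (n%:R * t))))%:E * (\1_(B x (n.+1%:R * t)) y)%:E)%E.
have f0 n y : (0 <= f n y)%E by rewrite mule_ge0 ?lee_fin ?expR_ge0.
have mf n : measurable_fun setT (f n).
  by apply: measurable_funeM; apply/measurable_EFinP; exact: measurable_indic.
apply: le_trans (_ : (_ <= \int[mu]_y \sum_(n <oo) f n y)%E) _.
  apply: ge0_le_integral => //.
  - exact: measurable_exp_dist.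
  - by apply: ge0_emeasurable_sum => // n y _; exact: f0.
  move=> y _; pose n := Num.truncn (D y x / t).
  have yx0 : 0 <= D y x / t by apply: divr_ge0; [exact: is_metric_ge0|exact: ltW].
  apply: le_trans (_ : (_ <= f n y)%E) _.
    have /andP[n1 n2] := truncn_itv yx0.
    rewrite /f indicE mem_set; last first.
      by rewrite /mball /= (is_metric_sym mD) -ltr_pdivrMr.
    rewrite mule1 lee_fin ler_expR lerN2; apply: ler_wpM2l => //.
    by rewrite -ler_pdivlMr.
  have := @nneseries_lim_ge R (f^~ y) xpredT 0%N n.+1 (fun k _ _ => f0 k y).
  by apply: le_trans; rewrite big_nat_recr//= leeDr// sume_ge0.
rewrite integral_nneseries//.
have fR := mball_fin x R00 (lexx _).
set m := mu (B x R0) in fR *.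
have term n : (\int[mu]_y f n y <= (q ^+ n)%:E * m)%E.
  rewrite /f ge0_integralZl_EFin ?expR_ge0//; last first.
    by apply/measurable_EFinP; exact: measurable_indic.
  rewrite integral_indic// setIT.
  have -> : q ^+ n = expR (- (b * (n%:R * t))) * (Cd ^+ 2) ^+ n.
    by rewrite /q exprMn -expRM_natl; congr (expR _ * _); ring.
  rewrite (EFinM (expR _)) -muleA; apply: lee_wpmul2l.
    by rewrite lee_fin expR_ge0.
  have [_ G] := mball_growth n x; apply: le_trans G.
  have Rt : R0 = t + t by rewrite /t; field.
  apply: le_mu => // y; rewrite /mball /= -natr1 mulrDl mul1r -/t => xy.
  by apply: lt_le_trans xy _; rewrite addrC lerD2r Rt lerDl ltW.
apply: le_trans (lee_nneseries _ (fun n _ => term n)) _.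
  by move=> n _ _; apply: integral_ge0.
apply: lime_le.
  by apply: is_cvg_nneseries => n _ _; rewrite mule_ge0 ?lee_fin ?exprn_ge0 ?measure_ge0.
near=> n; rewrite big_mkord -ge0_sume_distrl; last by move=> i _; rewrite lee_fin exprn_ge0.
rewrite sumEFin; apply: lee_wpmul2r; first exact: measure_ge0.
by rewrite lee_fin; exact: geometric_sum_le.
Unshelve. all: by end_near. Qed.

End LocalDoubling.

(** * Balls under the weighted measure *)

Lemma le_2pow_truncn (R : realType) (x : R) : x <= 2 ^+ (Num.truncn x).+1.
Proof.
apply: le_trans (ltW (truncnS_gt x)) _.
by rewrite -natrX ler_nat ltnW// ltn_expl.
Qed.

Section WeightedMeasure.
Context {R : realType} (d : measure_display) (T : measurableType d) (Y : Type).
Context (D : T -> T -> R) (z0 : T) (mu : {measure set T -> \bar R}).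
Context (dY : Y -> Y -> R) (iota : T -> Y) (M R0 Cd eps beta A : R).
Hypothesis mD : is_metric D.
Hypothesis gD : geodesic_space D.
Hypothesis completeD : mcomplete D.
Hypothesis unbD : munbounded D.
Hypothesis starD : roughly_starlike D z0 M.
Hypothesis bD : borel_measurable D.
Hypothesis R00 : 0 < R0.
Hypothesis dbl : doubling_upto D mu R0 Cd.
Hypothesis eps_gt0 : 0 < eps.
Hypothesis beta_ge0 : 0 <= beta.
Hypothesis cY : completion_of (d_eps D z0 eps) dY iota.
Hypothesis uA : uniform_space (d_eps D z0 eps) dY iota A.

Notation rho := (rho_eps D z0 eps).
Notation E := (d_eps D z0 eps).
Notation nu := (mu_beta D z0 mu beta).
Notation B := (mball D).

Let mY : is_metric dY. Proof. by case: cY. Qed.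
Let isoY x y : dY (iota x) (iota y) = E x y. Proof. by case: cY => _ [_ []]. Qed.
Let mB := measurable_mball mD bD.

(** Since [E <= D], the preimage is open for [D]. *)
Lemma measurable_completion_mball x r : measurable (iota @^-1` mball dY x r).
Proof.
apply: (measurable_mopen bD) => y; rewrite /mball /= => xy.
exists (r - dY x (iota y)); first by rewrite subr_gt0.
move=> y'; rewrite /mball /= => yy'.
have := is_metric_tri mY (iota y) x (iota y'); rewrite isoY.
have := d_eps_le_dist z0 mD gD eps_gt0 y y'; lra.
Qed.

Lemma preimage_completion_mball z r :
  iota @^-1` mball dY (iota z) r = mball E z r.
Proof. by apply/seteqP; split => y; rewrite /mball /= isoY. Qed.

Lemma measurable_d_eps_mball z r : measurable (mball E z r).
Proof. by rewrite -preimage_completion_mball; exact: measurable_completion_mball. Qed.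

Let mdens (U : set T) : measurable_fun U (fun y => (expR (- (beta * D y z0)))%:E).
Proof. exact: measurable_exp_dist. Qed.

Lemma le_mu_beta (U V : set T) : measurable U -> measurable V -> U `<=` V ->
  (nu U <= nu V)%E.
Proof.
move=> mU mV UV; exact: ge0_subset_integral.
Qed.

Lemma mu_beta_ge (U V : set T) c : measurable U -> measurable V -> U `<=` V ->
  0 <= c -> (forall y, U y -> c <= expR (- (beta * D y z0))) ->
  (c%:E * mu U <= nu V)%E.
Proof.
move=> mU mV UV c0 cU; apply: le_trans (le_mu_beta mU mV UV).
by rewrite -integral_cst//; apply: ge0_le_integral.
Qed.

Lemma mu_beta_le (U V : set T) c : measurable U -> measurable V -> U `<=` V ->
  0 <= c -> (forall y, U y -> expR (- (beta * D y z0)) <= c) ->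
  (nu U <= c%:E * mu V)%E.
Proof.
move=> mU mV UV c0 cU; apply: (@le_trans _ _ (c%:E * mu U)%E).
  by rewrite -integral_cst//; apply: ge0_le_integral.
by apply: lee_wpmul2l; [rewrite lee_fin|exact: le_mu].
Qed.

Let weight z := expR (- (beta * D z z0)).

(** The hypothesis places [B z s] inside the [E]-ball by [d_eps_le]; moving by less than [R0] lowers
    the weight by at most the factor [expR (- (beta * R0))]. *)
Lemma mu_beta_ball_ge a r z s : 0 < s -> s <= R0 ->
  expR (eps * R0) * rho z * s <= a * r ->
  ((weight z * expR (- (beta * R0)))%:E * mu (B z s) <= nu (mball E z (a * r)))%E.
Proof.
move=> s0 sR sa; apply: mu_beta_ge => //.
- exact: measurable_d_eps_mball.
- move=> y; rewrite /mball /= => zy; apply: lt_le_trans sa.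
  apply: le_lt_trans (d_eps_le z0 mD gD eps_gt0 z y) _.
  have c0 : 0 < expR (eps * R0) * rho z by rewrite mulr_gt0 ?expR_gt0 ?rho_gt0.
  apply: (@le_lt_trans _ _ (expR (eps * R0) * rho z * D z y)); last by rewrite ltr_pM2l.
  apply: ler_wpM2r; first exact: is_metric_ge0.
  by rewrite ler_pM2r ?rho_gt0// ler_expR ler_pM2l// ltW// (lt_le_trans zy).
- by rewrite mulr_ge0 ?expR_ge0.
move=> y; rewrite /mball /= => zy.
rewrite -expRD ler_expR -opprD lerN2 -mulrDr; apply: ler_wpM2l => //.
have := is_metric_tri mD z y z0; rewrite (is_metric_sym mD y z); lra.
Qed.

Lemma mball_fine_gt0 z s : 0 < s -> s <= R0 -> 0 < fine (mu (B z s)).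
Proof.
move=> s0 sR; rewrite -lte_fin fineK; last exact: mball_fin dbl _ _ s0 sR.
by apply: (mball_gt0 dbl) => //; have := R00; lra.
Qed.

(** Far from the boundary the [E]-balls lie between [D]-balls of radii at most [R0], on which the
    weight is nearly constant. The number [m] gives positivity, finiteness and comparability at
    once. *)
Lemma mu_beta_ball_interior a L r z k K : 0 < a -> a <= L -> 0 < r -> 0 < K ->
  2 * L <= K -> 4 * L <= K * eps * R0 ->
  K * eps * r <= rho z -> 4 * L * expR (eps * R0) / a <= 2 ^+ k ->
  exists2 m, 0 < m & (m%:E <= nu (mball E z (a * r)))%E /\
    (nu (mball E z (L * r)) <= (expR (2 * beta * R0) * Cd ^+ k * m)%:E)%E.
Proof.
move=> a0 aL r0 K0 KL KR Kz ak.
have rz := rho_gt0 D z0 eps z.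
have er := expR_gt0 (eps * R0).
have er1 : 1 <= expR (eps * R0).
  by rewrite -expR0 ler_expR mulr_ge0// ltW.
have L0 : 0 < L by exact: lt_le_trans aL.
(* [s1] is twice the bound from [dist_le_d_eps], so that the inclusion in an open ball is strict;
   [s2] is the largest radius allowed by [mu_beta_ball_ge]. *)
pose s1 := 4 * L * r / rho z.
pose s2 := a * r / (expR (eps * R0) * rho z).
have s10 : 0 < s1 by rewrite divr_gt0// !mulr_gt0.
have s20 : 0 < s2 by rewrite divr_gt0// !mulr_gt0.
have s1R : s1 <= R0.
  rewrite ler_pdivrMr//.
  have := ler_wpM2r (ltW R00) Kz; have := ler_wpM2r (ltW r0) KR; lra.
have s21 : s2 <= s1.
  rewrite ler_pdivrMr ?mulr_gt0// /s1.
  have -> : 4 * L * r / rho z * (expR (eps * R0) * rho z) =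
      4 * L * r * expR (eps * R0) by field; rewrite gt_eqF.
  have ar := ler_wpM2r (ltW r0) aL.
  have Lr : 0 < L * r by rewrite mulr_gt0.
  have := ler_wpM2l (ltW Lr) er1; lra.
have s2R : s2 <= R0 by exact: le_trans s1R.
have f2 := mball_fin dbl z s20 s2R.
set w := weight z * expR (- (beta * R0)).
have w0 : 0 < w by rewrite mulr_gt0 ?expR_gt0.
exists (w * fine (mu (B z s2))); first by rewrite mulr_gt0// mball_fine_gt0.
split.
  rewrite EFinM fineK//; apply: mu_beta_ball_ge => //.
  by rewrite /s2 mulrC divfK// gt_eqF// mulr_gt0.
apply: (@le_trans _ _ ((weight z * expR (beta * R0))%:E * mu (B z s1))%E).
  have sub y : mball E z (L * r) y -> B z s1 y.
    rewrite /mball /= => zy.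
    have : eps * D z y <= 2 * (eps * L * r / rho z).
      apply: (dist_le_d_eps (z0 := z0) mD gD eps_gt0).
        have -> : eps * L * r / rho z * rho z = eps * (L * r) by field; rewrite gt_eqF.
        by rewrite ler_pM2l// ltW.
      rewrite ler_pdivrMr//.
      have := ler_wpM2r (ltW (mulr_gt0 eps_gt0 r0)) KL; lra.
    have -> : 2 * (eps * L * r / rho z) = eps * (s1 / 2).
      by rewrite /s1; field; rewrite gt_eqF.
    by rewrite ler_pM2l//; lra.
  apply: mu_beta_le => //.
  - exact: measurable_d_eps_mball.
  - by rewrite mulr_ge0 ?expR_ge0.
  move=> y /sub; rewrite /mball /= => zy.
  rewrite -expRD ler_expR lerNl opprD opprK -mulrBr; apply: ler_wpM2l => //.
  have := is_metric_tri mD y z z0; lra.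
rewrite /w.
have -> : expR (2 * beta * R0) * Cd ^+ k *
    (weight z * expR (- (beta * R0)) * fine (mu (B z s2))) =
    weight z * expR (beta * R0) * (Cd ^+ k * fine (mu (B z s2))).
  have -> : expR (2 * beta * R0) = expR (beta * R0) * expR (beta * R0).
    by rewrite -expRD; congr expR; ring.
  have e1 : expR (beta * R0) * expR (- (beta * R0)) = 1 by rewrite -expRD subrr expR0.
  by rewrite -[RHS]mul1r -{1}e1; ring.
rewrite [leRHS]EFinM; apply: lee_wpmul2l; first by rewrite lee_fin mulr_ge0 ?expR_ge0.
rewrite EFinM fineK//; apply: (doubling_iter mD bD R00 dbl) => //.
  by have := R00; lra.
apply: le_trans (ler_wpM2r (ltW s20) ak).
suff -> : 4 * L * expR (eps * R0) / a * s2 = s1 by [].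
by rewrite /s2 /s1; field; rewrite !gt_eqF.
Qed.

(** Near the boundary the large [E]-ball may be unbounded for [D]. By [ball_behind_center] its
    weight is at most a multiple of [expR (- (beta * D y z))], which can be integrated over the
    whole space; [k] doublings then lead from [B z R0] down to [B z s]. *)
Lemma mu_beta_ball_boundary a L r z n k K s : 0 < a -> a <= 1 / 8 -> 0 <= L -> 0 < r ->
  r <= 4 / eps -> (forall w, bdry iota w -> 2 * a * r <= dY (iota z) w) ->
  rho z <= K * eps * r -> 0 < s -> s <= R0 -> expR (eps * R0) * K * eps * s <= a ->
  A * (L + 1) <= n%:R * (a / (2 * A * whitney_const eps M * eps)) ->
  R0 <= 2 ^+ k * s -> expR (- (beta * (R0 / 2))) * Cd ^+ 2 < 1 ->
  exists2 m, 0 < m & (m%:E <= nu (mball E z (a * r)))%E /\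
    (nu (mball E z (L * r)) <= (expR (beta * (2 * n%:R / eps + R0)) *
       (1 - expR (- (beta * (R0 / 2))) * Cd ^+ 2)^-1 * Cd ^+ k * m)%:E)%E.
Proof.
move=> a0 a8 L0 r0 reps deep zK s0 sR sa nL Rk q1.
set q := expR (- (beta * (R0 / 2))) * Cd ^+ 2 in q1 *.
have fs := mball_fin dbl z s0 sR.
set w := weight z * expR (- (beta * R0)).
have w0 : 0 < w by rewrite mulr_gt0 ?expR_gt0.
exists (w * fine (mu (B z s))); first by rewrite mulr_gt0// mball_fine_gt0.
split.
  rewrite EFinM fineK//; apply: mu_beta_ball_ge => //.
  have es : 0 <= expR (eps * R0) * s by rewrite mulr_ge0 ?expR_ge0// ltW.
  have := ler_wpM2l es zK; have := ler_wpM2r (ltW r0) sa; lra.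
set N := 2 * n%:R / eps.
have behind y : mball E z (L * r) y -> D z z0 + D y z <= D y z0 + N.
  rewrite /mball /= => zy.
  apply: (ball_behind_center mD gD eps_gt0 cY uA completeD unbD starD a0 a8 r0 reps deep _ nL).
  by rewrite (d_eps_sym cY) ltW.
apply: (@le_trans _ _
    (\int[mu]_y ((weight z * expR (beta * N))%:E * (expR (- (beta * D y z)))%:E))%E).
  apply: (@le_trans _ _ (\int[mu]_(y in mball E z (L * r))
      ((weight z * expR (beta * N))%:E * (expR (- (beta * D y z)))%:E))%E).
    apply: ge0_le_integral => //.
    - exact: measurable_d_eps_mball.
    - by apply: measurable_funeM; exact: measurable_exp_dist.
    move=> y /behind yz; rewrite -EFinM lee_fin -!expRD ler_expR.
    have := ler_wpM2l beta_ge0 yz; lra.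
  apply: ge0_subset_integral => //.
  - exact: measurable_d_eps_mball.
  - by apply: measurable_funeM; exact: measurable_exp_dist.
  - by move=> y _; rewrite mule_ge0 ?lee_fin ?mulr_ge0 ?expR_ge0.
rewrite ge0_integralZl_EFin//; last 2 first.
- exact: measurable_exp_dist.
- by rewrite mulr_ge0 ?expR_ge0.
have q10 : 0 < 1 - q by rewrite subr_gt0.
apply: (@le_trans _ _ ((weight z * expR (beta * N))%:E *
    ((1 - q)^-1%:E * ((Cd ^+ k)%:E * mu (B z s))))%E).
  apply: lee_wpmul2l; first by rewrite lee_fin mulr_ge0 ?expR_ge0.
  apply: le_trans (integral_exp_dist_le mD gD bD R00 dbl z beta_ge0 q1) _.
  apply: lee_wpmul2l; first by rewrite lee_fin invr_ge0 ltW.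
  by apply: (doubling_iter mD bD R00 dbl) => //; have := R00; lra.
rewrite -(fineK fs) -!EFinM lee_fin le_eqVlt; apply/orP; left; apply/eqP.
rewrite mulrDr expRD /w.
have e1 : expR (beta * R0) * expR (- (beta * R0)) = 1 by rewrite -expRD subrr expR0.
by rewrite -[LHS]mul1r -{1}e1; ring.
Qed.

End WeightedMeasure.

(** * Uniform constants and the doubling property *)

Lemma supercritical_weight (R : realType) (Cd R0 beta : R) :
  1 <= Cd -> 0 < R0 -> 17 * ln Cd / (3 * R0) < beta ->
  0 <= beta /\ expR (- (beta * (R0 / 2))) * Cd ^+ 2 < 1.
Proof.
move=> C1 R00 hb; have l0 : 0 <= ln Cd by exact: ln_ge0.
have C0 : 0 < Cd by lra.
have R30 : 0 < 3 * R0 by lra.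
split.
  apply: le_trans (ltW hb); apply: divr_ge0; last exact: ltW.
  by rewrite mulr_ge0.
(* In logarithms the claim reads [4 * ln Cd < beta * R0], and [4 < 17 / 3]. *)
move: hb; rewrite ltr_pdivrMr// => hb.
have -> : Cd ^+ 2 = expR (2 * ln Cd) by rewrite expRM_natl lnK.
by rewrite -expRD -[ltRHS]expR0 ltr_expR; lra.
Qed.

(** The constant is chosen before the space, which is how its dependence on the parameters alone is
    expressed. *)
Lemma mu_beta_ball_comparable (R : realType) (delta M R0 Cd eps beta A a L : R) :
  0 < eps -> 17 * ln Cd / (3 * R0) < beta -> 0 < a -> a <= 1 / 8 -> a <= L ->
  exists2 C : R, 1 <= C &
  forall (d : measure_display) (T : measurableType d) (D : T -> T -> R) (z0 : T)
         (mu : {measure set T -> \bar R}) (Y : Type) (dY : Y -> Y -> R) (iota : T -> Y),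
    standing D z0 mu delta M R0 Cd -> completion_of (d_eps D z0 eps) dY iota ->
    uniform_space (d_eps D z0 eps) dY iota A ->
    forall z r, 0 < r -> r <= 4 / eps ->
    (forall w, bdry iota w -> 2 * a * r <= dY (iota z) w) ->
    exists2 m, 0 < m &
      (m%:E <= mu_beta D z0 mu beta (mball (d_eps D z0 eps) z (a * r)))%E /\
      (mu_beta D z0 mu beta (mball (d_eps D z0 eps) z (L * r)) <= (C * m)%:E)%E.
Proof.
move=> eps0 hb a0 a8 aL.
have L0 : 0 < L by exact: lt_le_trans aL.
(* [K] separates the two regimes and is the least value the interior case allows. Signs of [A], [M],
   [Cd] and [R0] are still unknown here; they come with the space. *)
pose K := Num.max (2 * L) (4 * L / (eps * R0)).
pose s := Num.min R0 (a / (expR (eps * R0) * K * eps)).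
pose k1 := (Num.truncn (4 * L * expR (eps * R0) / a)).+1.
pose k2 := (Num.truncn (R0 / s)).+1.
pose c := a / (2 * A * whitney_const eps M * eps).
pose n := (Num.truncn (A * (L + 1) / c)).+1.
pose C1 := expR (2 * beta * R0) * Cd ^+ k1.
pose C2 := expR (beta * (2 * n%:R / eps + R0)) *
  (1 - expR (- (beta * (R0 / 2))) * Cd ^+ 2)^-1 * Cd ^+ k2.
exists (Num.max 1 (Num.max C1 C2)); first by rewrite le_max lexx.
move=> d T D z0 mu Y dY iota [[[mD [completeD [unbD [gD _]]]] [_ starD]] [bD [R00 dbl]]].
move=> cY uA z r r0 reps deep.
have Cd1 := doubling_const_ge1 mD bD R00 dbl.
have [beta0 q1] := supercritical_weight Cd1 R00 hb.
have A1 := uniform_const_ge1 mD gD eps0 uA unbD.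
have K0 : 0 < K by rewrite lt_max mulr_gt0.
have weaken c' : c' <= Num.max C1 C2 -> (exists2 m, 0 < m &
      (m%:E <= mu_beta D z0 mu beta (mball (d_eps D z0 eps) z (a * r)))%E /\
      (mu_beta D z0 mu beta (mball (d_eps D z0 eps) z (L * r)) <= (c' * m)%:E)%E) ->
    exists2 m, 0 < m &
      (m%:E <= mu_beta D z0 mu beta (mball (d_eps D z0 eps) z (a * r)))%E /\
      (mu_beta D z0 mu beta (mball (d_eps D z0 eps) z (L * r)) <=
        (Num.max 1 (Num.max C1 C2) * m)%:E)%E.
  move=> cC [m m0 [lo hi]]; exists m => //; split => //; apply: le_trans hi _.
  by rewrite lee_fin ler_pM2r// le_max cC orbT.
have [zK|Kz] := leP (K * eps * r) (rho_eps D z0 eps z).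
  apply: (@weaken C1); first by rewrite le_max lexx.
  apply: (mu_beta_ball_interior mD gD bD R00 dbl eps0 beta0 cY (K := K)) => //.
  - by rewrite le_max lexx.
  - rewrite -mulrA -ler_pdivrMr ?mulr_gt0//.
    by rewrite le_max lexx orbT.
  - exact: le_2pow_truncn.
have W0 : 0 < whitney_const eps M.
  by case: starD => M0 _; rewrite mulr_gt0 ?expR_gt0// !addr_gt0// invr_gt0.
have c0 : 0 < c by rewrite divr_gt0//; do 3![apply: mulr_gt0 => //]; lra.
have eK0 : 0 < expR (eps * R0) * K * eps by do 2![apply: mulr_gt0 => //]; exact: expR_gt0.
have s0 : 0 < s by rewrite lt_min R00 divr_gt0.
have sR : s <= R0 by rewrite ge_min lexx.
apply: (@weaken C2); first by rewrite le_max lexx orbT.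
apply: (mu_beta_ball_boundary mD gD completeD unbD starD bD R00 dbl eps0 beta0 cY uA
  (K := K) (s := s)) => //.
- exact: ltW.
- exact: ltW.
- by rewrite mulrC -ler_pdivlMr// ge_min lexx orbT.
- by rewrite -ler_pdivrMr//; apply: ltW; exact: truncnS_gt.
- by rewrite -ler_pdivrMr//; exact: le_2pow_truncn.
Qed.

Theorem theorem4p9 (R : realType) (eps0 A : R -> R) (delta M eps Cd R0 beta : R) :
  BHK_property eps0 A ->
  0 < eps -> eps <= eps0 delta ->
  17 * ln Cd / (3 * R0) < beta ->
  (forall (d : measure_display) (T : measurableType d) (D : T -> T -> R) (z0 : T)
          (mu : {measure set T -> \bar R}) (Y : Type) (dY : Y -> Y -> R) (iota : T -> Y),
     standing D z0 mu delta M R0 Cd ->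
     completion_of (d_eps D z0 eps) dY iota ->
     globally_doubling dY (fun S => mu_beta D z0 mu beta (iota @^-1` S)) /\
     globally_doubling (d_eps D z0 eps) (mu_beta D z0 mu beta)) /\
  (forall a0 : R, 0 < a0 -> a0 < Num.min (1 / 8) (1 / (6 * A delta)) ->
   exists C : R, 1 <= C /\
   forall (d : measure_display) (T : measurableType d) (D : T -> T -> R) (z0 : T)
          (mu : {measure set T -> \bar R}) (Y : Type) (dY : Y -> Y -> R) (iota : T -> Y),
     standing D z0 mu delta M R0 Cd ->
     completion_of (d_eps D z0 eps) dY iota ->
     forall (x : Y) (r : R), 0 < r -> r <= 2 * diam (d_eps D z0 eps) ->
       (exists z : T, mball dY (iota z) (a0 * r) `<=` mball dY x r /\
          forall w, bdry iota w -> 2 * a0 * r <= dY (iota z) w) /\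
       (forall z : T, mball dY (iota z) (a0 * r) `<=` mball dY x r ->
          (forall w, bdry iota w -> 2 * a0 * r <= dY (iota z) w) ->
          (mu_beta D z0 mu beta (iota @^-1` mball dY x r)
             <= C%:E * mu_beta D z0 mu beta (iota @^-1` mball dY (iota z) (a0 * r)))%E /\
          (mu_beta D z0 mu beta (iota @^-1` mball dY (iota z) (a0 * r))
             <= C%:E * mu_beta D z0 mu beta (iota @^-1` mball dY x r))%E)).
Proof.
move=> BHK e0 ee hb.
(* The center [z] lies in the ball of radius [r] about [x], so passing to center [z] costs at most
   [r]. *)
have near T Y (D : T -> T -> R) z0 (dY : Y -> Y -> R) (iota : T -> Y) a x r L z y :
    completion_of (d_eps D z0 eps) dY iota -> 0 < a -> 0 < r ->
    mball dY (iota z) (a * r) `<=` mball dY x r -> mball dY x (L * r) (iota y) ->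
    mball (d_eps D z0 eps) z ((L + 1) * r) y.
  move=> [mY [_ [isoY _]]] a00 r0 sub.
  have := sub (iota z); rewrite /mball /= is_metric_refl// mulr_gt0// => /(_ isT) xz xy.
  rewrite -isoY; have := is_metric_tri mY x (iota z) (iota y).
  by rewrite (is_metric_sym mY _ x); lra.
split.
  move=> d T D z0 mu Y dY iota st cY.
  have [hyp [bD [R00 dbl]]] := st.
  have [[mD [completeD [unbD [gD _]]]] _] := hyp.
  have [uA _] := BHK T Y D z0 delta M eps dY iota hyp e0 ee cY.
  have A1 := uniform_const_ge1 mD gD e0 uA unbD.
  have mY : is_metric dY by case: cY.
  (* Any admissible [a0] would do for doubling. *)
  set a := Num.min (1 / 8) (1 / (6 * A delta)) / 2.
  have b0 : 0 < Num.min (1 / 8) (1 / (6 * A delta)).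
    by rewrite lt_min !divr_gt0//; lra.
  have a0 : 0 < a by rewrite divr_gt0.
  have : a < Num.min (1 / 8) (1 / (6 * A delta)) by rewrite /a; lra.
  rewrite lt_min => /andP[a8 aA].
  (* The ball of radius [2 * r] about [x] lies in that of radius [3 * r] about [z]. *)
  have a3 : a <= 2 + 1 by lra.
  have [C C1 /(_ d T D z0 mu Y dY iota st cY uA) comp] :=
    mu_beta_ball_comparable delta M (A delta) e0 hb a0 (ltW a8) a3.
  have diam_le := diam_d_eps_le mD gD e0 cY.
  set nu := fun S => mu_beta D z0 mu beta (iota @^-1` S).
  have meas x r := measurable_completion_mball mD gD bD e0 cY x r.
  have dY_doubling x r : 0 < r -> r <= 2 * diam (d_eps D z0 eps) ->
      [/\ (0 < nu (mball dY x (2 * r)))%E,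
          (nu (mball dY x (2 * r)) <= C%:E * nu (mball dY x r))%E
        & (nu (mball dY x r) < +oo)%E].
    move=> r0 rd.
    have [z [sub deep]] := corkscrew mD gD e0 cY uA x completeD a0 a8 aA r0 rd.
    have [|m m0 [lo hi]] := comp z r r0 _ deep; first lra.
    have hi2 : (nu (mball dY x (2 * r)) <= (C * m)%:E)%E.
      apply: le_trans hi; apply: (le_mu_beta z0 mu beta mD bD) => //.
        exact: (measurable_d_eps_mball mD gD bD e0 cY).
      by move=> y; apply: near cY a0 r0 sub.
    have lo1 : (m%:E <= nu (mball dY x r))%E.
      apply: le_trans lo _; rewrite -(preimage_completion_mball cY).
      apply: (le_mu_beta z0 mu beta mD bD) => // y; exact: sub.
    have r12 : (nu (mball dY x r) <= nu (mball dY x (2 * r)))%E.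
      by apply: (le_mu_beta z0 mu beta mD bD) => // y; rewrite /mball /=; lra.
    split.
    - by apply: lt_le_trans (le_trans lo1 r12); rewrite lte_fin.
    - apply: le_trans hi2 _; rewrite EFinM; apply: lee_wpmul2l => //.
      by rewrite lee_fin; lra.
    - by apply: le_lt_trans (le_trans r12 hi2) _; rewrite ltry.
  have dbY : globally_doubling dY nu.
    exists C => x r r0.
    have [rd|dr] := leP r (2 * diam (d_eps D z0 eps)); first exact: dY_doubling.
    have dpos := diam_d_eps_gt0 mD gD e0 cY unbD.
    (* For radii beyond [2 * diam] all balls involved are the whole space, which reduces the claim
       to the radius [2 * diam]. *)
    have full s : diam (d_eps D z0 eps) < s -> mball dY x s = setT.
      move=> ds; apply/seteqP; split => // y _; rewrite /mball /=.
      exact: le_lt_trans (completion_dist_le_diam mD gD e0 cY x y) ds.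
    have := dY_doubling x (2 * diam (d_eps D z0 eps)).
    rewrite !full; try lra.
    by apply => //; lra.
  (* Balls of the uniformized space are preimages of completion balls centered in the image of
     [iota]. *)
  split => //; have [C' HC'] := dbY; exists C' => x r r0.
  by have := HC' (iota x) r r0; rewrite /nu !(preimage_completion_mball cY).
move=> a a0; rewrite lt_min => /andP[a8 aA].
have a2 : a <= 1 + 1 by lra.
have [C C1 comp] := mu_beta_ball_comparable delta M (A delta) e0 hb a0 (ltW a8) a2.
exists C; split => // d T D z0 mu Y dY iota st cY x r r0 rd.
have [hyp [bD [R00 dbl]]] := st.
have [[mD [completeD [unbD [gD _]]]] _] := hyp.
have [uA _] := BHK T Y D z0 delta M eps dY iota hyp e0 ee cY.
have meas x' r' := measurable_completion_mball mD gD bD e0 cY x' r'.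
have diam_le := diam_d_eps_le mD gD e0 cY.
split; first exact: (corkscrew mD gD e0 cY uA x completeD a0 a8 aA r0 rd).
move=> z sub deep.
have [|m m0 [lo hi]] := comp d T D z0 mu Y dY iota st cY uA z r r0 _ deep; first lra.
have mono : (mu_beta D z0 mu beta (iota @^-1` mball dY (iota z) (a * r)) <=
    mu_beta D z0 mu beta (iota @^-1` mball dY x r))%E.
  by apply: (le_mu_beta z0 mu beta mD bD) => // y; exact: sub.
split.
  apply: (@le_trans _ _ (C * m)%:E).
    apply: le_trans hi; apply: (le_mu_beta z0 mu beta mD bD) => //.
      exact: (measurable_d_eps_mball mD gD bD e0 cY).
    by move=> y /= xy; apply: near cY a0 r0 sub _; rewrite mul1r.
  rewrite EFinM (preimage_completion_mball cY); apply: lee_wpmul2l => //.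
  by rewrite lee_fin; lra.
apply: le_trans mono _.
rewrite -[leLHS]mul1e; apply: lee_wpmul2r; last by rewrite lee_fin.
by apply: integral_ge0 => y _; rewrite lee_fin expR_ge0.
Qed.
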